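(* For each $i=1,\dots,d$, there is a short exact sequence $$0\to W_L^T\xrightarrow{\;e_{\alpha^{(i)}}\;}W_L^T\xrightarrow{\;\Delta_c^T(\lambda^{(i)},-x)\;}W_L^T\to0 .$$
   Context: **Lattice data.** $L=\mathbb{Z}\alpha_1\oplus\cdots\oplus\mathbb{Z}\alpha_D$ is a positive definite even lattice with symmetric $\mathbb{Z}$-bilinear form $\langle\cdot,\cdot\rangle$ such that $\langle\alpha_i,\alpha_j\rangle\ge 0$ for all $i,j$. $\nu:L\to L$ is an isometry of finite order $v$ permuting $\alpha_1,\dots,\alpha_D$; $k=2v$; $\eta\in\mathbb{C}$ is a primitive $k$-th root of unity, and for $r\mid k$ we put $\eta_r=\eta^{k/r}$. The permutation has $d$ cycles, of lengths $l_1,\dots,l_d$, and the basis is numbered so that $\nu=(1,\dots,l_1)(l_1+1,\dots,l_1+l_2)\cdots$; put $\alpha^{(r)}=\alpha_{l_1+\cdots+l_{r-1}+1}$ and $\alpha^{(r)}_j=\nu^{j-1}\alpha^{(r)}$ ($1\le j\le l_r$). Let $\mathfrak h=L\otimes_{\mathbb Z}\mathbb{C}$ with the extended form and extended $\nu$; $\mathfrak h_{(n)}=\{h:\nu h=\eta^n h\}$ ($n\in\mathbb Z$), and $h_{(n)}$ is the projection of $h$ to $\mathfrak h_{(n)}$; in particular $h_{(0)}=\frac1k\sum_{j=0}^{k-1}\nu^jh$. Say $\alpha^{(i)}$ satisfies the *evenness condition* if $l_i$ is odd, or $l_i$ is even and $\langle\alpha^{(i)},\nu^{l_i/2}\alpha^{(i)}\rangle\in2\mathbb{Z}$.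 Put $N=\{\alpha\in L:\langle\alpha,\mathfrak h_{(0)}\rangle=0\}$, $M=(1-\nu)L$, $R=\{\alpha\in N: C_N(\alpha,\beta)=1\ \forall\beta\in N\}$ with $C_N(\alpha,\beta)=\eta^{\sum_{j=0}^{k-1}j\langle\nu^j\alpha,\beta\rangle}$. It is assumed that $N=M=R$. **Central extensions.** $\hat L$ is the central extension of $L$ by $\langle\eta\rangle$ with normalized section $\alpha\mapsto e_\alpha$ and $e_\alpha e_\beta=\epsilon(\alpha,\beta)e_{\alpha+\beta}$, where $\epsilon$ is bimultiplicative with $\epsilon(\alpha_i,\alpha_j)=1$ if $i\le j$ and $(-1)^{\langle\alpha_i,\alpha_j\rangle}$ if $i>j$; its commutator map is $(-1)^{\langle\alpha,\beta\rangle}$. $\hat\nu$ is the automorphism of $\hat L$ fixing $\eta$ such that, for $\alpha$ in the orbit of $\alpha^{(r)}$, $\hat\nu e_\alpha=e_{\nu\alpha}$ if $\alpha^{(r)}$ satisfies the evenness condition and $\hat\nu e_\alpha=\eta_{2l_r}e_{\nu\alpha}$ otherwise. $\hat L_\nu$ is the same set as $\hat L$ with product $\times_\nu$ determined by $a\times b=\prod_{0<j<k/2}(-\eta^j)^{\langle\nu^{-j}\bar a,\bar b\rangle}\,a\times_\nu b$ (bar is the projection to $L$); its commutator map is $C(\alpha,\beta)=\prod_{j=0}^{k-1}(-\eta^j)^{\langle\nu^j\alpha,\beta\rangle}$, and $\hat\nu$ is also an automorphism of $\hat L_\nu$. $\hat N\subset\hat L_\nu$ is the preimage of $N$, and $\tau:\hat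 N\to\mathbb C^\times$ is the unique homomorphism with $\tau(\eta)=\eta$ and $\tau(a\,\hat\nu a^{-1})=\eta^{-\frac12\sum_{j=0}^{k-1}\langle\nu^j\bar a,\bar a\rangle}$ for $a\in\hat L_\nu$. **Twisted module.** $\hat{\mathfrak h}[\nu]=\coprod_{n\in\frac1k\mathbb Z}\mathfrak h_{(kn)}\otimes t^n\oplus\mathbb C\mathbf k$ with $\mathbf k$ central and $[\alpha\otimes t^m,\beta\otimes t^n]=\langle\alpha,\beta\rangle m\delta_{m+n,0}\mathbf k$; write $\alpha(n)=\alpha\otimes t^n$. $S[\nu]$ is the $\hat{\mathfrak h}[\nu]$-module induced from the trivial module $\mathbb C$ of $\coprod_{n\ge0}\mathfrak h_{(kn)}\otimes t^n$, with $\mathbf k=1$. $U_T=\mathbb C[\hat L_\nu]\otimes_{\mathbb C[\hat N]}\mathbb C_\tau\cong\mathbb C[L/N]$. $V_L^T=S[\nu]\otimes U_T$: $\hat L_\nu$ acts on $U_T$ by left multiplication, and for $h\in\mathfrak h_{(0)}$ the operator $x^h$ acts on $b\otimes1\in U_T$ by $x^{\langle h,\bar b\rangle}$. Put $1_T=1\otimes(1\otimes1)$. For $\alpha\in\mathfrak h$, $$E^\pm(-\alpha,x)=\exp\Big(\sum_{n\in\pm\frac1k\mathbb Z_+}\frac{-\alpha_{(kn)}(n)}{n}x^{-n}\Big),$$ and for $\alpha\in L$, $\sigma(\alpha)=\prod_{0<j<k/2}(1-\eta^{-j})^{\langle\nu^j\alpha,\alpha\rangle}\,2^{\langle\nu^{k/2}\alpha,\alpha\rangle/2}$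 and $$Y^{\hat\nu}(e^\alpha,x)=k^{-\langle\alpha,\alpha\rangle/2}\sigma(\alpha)E^-(-\alpha,x)E^+(-\alpha,x)\,e_\alpha\,x^{\alpha_{(0)}+\frac{\langle\alpha_{(0)},\alpha_{(0)}\rangle}{2}-\frac{\langle\alpha,\alpha\rangle}{2}}=\sum_{m\in\frac1k\mathbb Z}(e^\alpha)^{\hat\nu}_m x^{-m-\langle\alpha,\alpha\rangle/2}.$$ These are the operators attached to $e^\alpha\in V_L$ in the $\hat\nu$-twisted module $V_L^T$ for the lattice vertex operator algebra $V_L$. **Principal subspace.** $W_L\subset V_L$ is the vertex subalgebra generated by $e^{\alpha_1},\dots,e^{\alpha_D}$ and $W_L^T=W_L\cdot1_T\subset V_L^T$; concretely $W_L^T$ is the span of all $(e^{\alpha_{i_1}})^{\hat\nu}_{m_1}\cdots(e^{\alpha_{i_s}})^{\hat\nu}_{m_s}1_T$ with $s\ge0$, $m_j\in\frac1k\mathbb Z$. The operators $(e^{\alpha_i})^{\hat\nu}_m$ all commute, and $(e^{\nu^r\alpha^{(i)}})^{\hat\nu}_m$ is a scalar multiple of $(e^{\alpha^{(i)}})^{\hat\nu}_m$, so only the $\alpha^{(i)}$ are needed. **The maps.** $e_{\alpha^{(i)}}:V_L^T\to V_L^T$ is the action of $e_{\alpha^{(i)}}\in\hat L_\nu$ (on the factor $U_T$), restricted to $W_L^T$, which it maps to itself. Let $\{\lambda_1,\dots,\lambda_D\}\subset\mathbb Q\otimes L$ be the basis dual to $\{\alpha_1,\dots,\alpha_D\}$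 and $\lambda^{(i)}$ the dual basis element corresponding to $\alpha^{(i)}$. Then $$\Delta^T(\lambda^{(i)},-x)=\Big(\prod_{j=0}^{l_i-1}(-\eta_{l_i}^j)^{-\nu^j\lambda^{(i)}}\Big)x^{\lambda^{(i)}_{(0)}}E^+(-\lambda^{(i)},x),$$ where the first factor acts on a monomial $(e^{\alpha^{(i_1)}})^{\hat\nu}_{n_1}\cdots(e^{\alpha^{(i_s)}})^{\hat\nu}_{n_s}1_T$ as the scalar $(-1)^{\#\{p:\,i_p=i\}}$. $\Delta_c^T(\lambda^{(i)},-x)$ denotes the constant term (coefficient of $x^0$) of $\Delta^T(\lambda^{(i)},-x)$; on $W_L^T$ it is the linear map $$(e^{\alpha^{(i_1)}})^{\hat\nu}_{n_1}\cdots(e^{\alpha^{(i_s)}})^{\hat\nu}_{n_s}1_T\mapsto(e^{\alpha^{(i_1)}})^{\hat\nu}_{n_1+\delta_{i,i_1}/l_i}\cdots(e^{\alpha^{(i_s)}})^{\hat\nu}_{n_s+\delta_{i,i_s}/l_i}1_T .$$ *)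

(* Defs.v *)
From HB Require Import structures.
From mathcomp Require Import all_boot all_order all_algebra.
From mathcomp Require Import fingroup perm generic_quotient ring_quotient.
From mathcomp Require Import finmap boolp classical_sets cardinality fsbigop.
From mathcomp Require Import reals complex.
From mathcomp Require Import monalg.

Set Implicit Arguments.
Unset Strict Implicit.
Unset Printing Implicit Defensive.

Import GRing.Theory.
Local Open Scope classical_set_scope.
Local Open Scope ring_scope.
Local Open Scope quotient_scope.

Section Presentation.
Variable C : fieldType.

Definition lspan (V : lmodType C) (P : set V) : set V :=
  [set x | exists2 s : seq (C * V), (forall p, p \in s -> P p.2)
                                  & x = \sum_(p <- s) p.1 *: p.2].

Lemma lspan0 (V : lmodType C) (P : set V) : lspan P 0.
Proof. by exists [::]; rewrite ?big_nil. Qed.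

Lemma lspanD (V : lmodType C) (P : set V) x y :
  lspan P x -> lspan P y -> lspan P (x + y).
Proof.
move=> [s sP ->] [t tP ->]; exists (s ++ t); last by rewrite big_cat.
by move=> p; rewrite mem_cat => /orP[/sP|/tP].
Qed.

Lemma lspanZ (V : lmodType C) (P : set V) (a : C) x :
  lspan P x -> lspan P (a *: x).
Proof.
move=> [s sP ->]; exists [seq (a * p.1, p.2) | p <- s].
  by move=> _ /mapP[q qs ->]; exact: sP qs.
by rewrite big_map scaler_sumr; apply: eq_bigr => p _; rewrite scalerA.
Qed.

Variables (K : choiceType) (rel : set {malg C[K]}).

Definition relspan : {pred {malg C[K]}} := fun x => `[< lspan rel x >].

Lemma relspan_zmod_closed : zmod_closed relspan.
Proof.
split=> [|x y]; first exact/asboolP/lspan0.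
rewrite !unfold_in => /asboolP xP /asboolP yP; apply/asboolP.
by rewrite -scaleN1r; apply: lspanD => //; exact: lspanZ.
Qed.
HB.instance Definition _ :=
  GRing.isZmodClosed.Build {malg C[K]} relspan relspan_zmod_closed.

(* The quotient of the free vector space on K by the span of rel. *)
Definition presented := Quotient.quot relspan.
HB.instance Definition _ := GRing.Zmodule.on presented.

Definition pscale (a : C) (x : presented) : presented :=
  \pi_(Quotient.quot relspan) (a *: repr x).

Lemma pi_pscale (a : C) (x : {malg C[K]}) :
  pscale a (\pi_(Quotient.quot relspan) x)
    = \pi_(Quotient.quot relspan) (a *: x).
Proof.
apply/eqP; rewrite /pscale -Quotient.idealrBE -scalerBr unfold_in.
apply/asboolP/lspanZ/asboolP.
have : repr (\pi_(Quotient.quot relspan) x) - x \in relspan.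
  by rewrite Quotient.idealrBE reprK.
by rewrite unfold_in.
Qed.

Lemma pscaleA (a b : C) (x : presented) :
  pscale a (pscale b x) = pscale (a * b) x.
Proof. by rewrite [pscale b x]/pscale pi_pscale scalerA. Qed.
Lemma pscale1 : left_id 1 pscale.
Proof. by move=> x; rewrite /pscale scale1r reprK. Qed.
Lemma pscaleDr : right_distributive pscale +%R.
Proof.
move=> a x y; rewrite -[x]reprK -[y]reprK.
rewrite (_ : _ + _ = \pi_(Quotient.quot relspan) (repr x + repr y)).
  by rewrite !pi_pscale scalerDr; exact: raddfD.
exact/esym/raddfD.
Qed.
Lemma pscaleDl (x : presented) : {morph pscale^~ x : a b / a + b}.
Proof. by move=> a b; rewrite /pscale scalerDl; exact: raddfD. Qed.
HB.instance Definition _ := GRing.Zmodule_isLmodule.Build C presented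
  pscaleA pscale1 pscaleDr pscaleDl.

Definition pgen (k : K) : presented :=
  \pi_(Quotient.quot relspan) << 1 *g k >>.

(* The linear map sending the generator k to f k. It is computed on a
   representative, so it is that linear map whenever the linear extension of f
   to the free vector space kills rel; this is so for all the uses below. *)
Definition plift (W : lmodType C) (f : K -> W) (x : presented) : W :=
  let y : {malg C[K]} := repr x in \sum_(k <- msupp y) y@_k *: f k.

End Presentation.

Section Tensor.
Variable C : fieldType.

Inductive tensor_rel (S U : lmodType C) : set {malg C[(S * U)%type]} :=
| TensorRelL a (s s' : S) (u : U) : tensor_rel
    (<< 1 *g (a *: s + s', u) >> - a *: << 1 *g (s, u) >> - << 1 *g (s', u) >>)
| TensorRelR a (s : S) (u u' : U) : tensor_rel
    (<< 1 *g (s, a *: u + u') >> - a *: << 1 *g (s, u) >> - << 1 *g (s, u') >>).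

Definition tensor (S U : lmodType C) : lmodType C :=
  presented (@tensor_rel S U).

Definition tens (S U : lmodType C) (s : S) (u : U) : tensor S U :=
  pgen (@tensor_rel S U) (s, u).

Definition tensor_map (S U : lmodType C) (f : S -> S) (g : U -> U) :
    tensor S U -> tensor S U :=
  plift (fun su => tens (f su.1) (g su.2)).

(* The coefficient of y^q in exp (\sum_(n >= 1) c n y^n), expanded as
   \sum_m (\sum_(n >= 1) c n y^n)^m / m!; a sequence t below is a choice of one
   term in each of the m factors. *)
Definition exp_coef (V : lmodType C) (c : nat -> V -> V) (q : nat) (v : V) : V :=
  \sum_(m < q.+1) (m`!%:R)^-1 *:
    \sum_(t : m.-tuple 'I_q.+1 |
            all (fun n : 'I_q.+1 => (0 < n)%N) t && (\sum_(n <- t) n == q)%N)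
      foldr (fun (n : 'I_q.+1) w => c n w) v t.

Definition linear_on (V : lmodType C) (A B : set V) (f : V -> V) : Prop :=
  (forall x, A x -> B (f x)) /\
  (forall a x y, A x -> A y -> f (a *: x + y) = a *: f x + f y).

(* 0 -> A -f-> B -g-> D -> 0, for subspaces A, B and D of V. *)
Definition short_exact (V : lmodType C) (A B D : set V) (f g : V -> V) : Prop :=
  [/\ linear_on A B f, linear_on B D g,
      forall x, A x -> f x = 0 -> x = 0,
      f @` A = [set y | B y /\ g y = 0]
    & g @` B = D].

End Tensor.

(* L = Z^D with basis the standard row vectors, gram its Gram matrix, nu the
   permutation of the basis. The index tagnat.Rank r j, for j : 'I_(len r), is
   len 0 + .. + len (r - 1) + j (see tagnat.rankEsum). *)

Record lattice_data := LatticeData {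
  ncyc : nat;
  len : 'I_ncyc -> nat;
  len_gt0 : forall r, (0 < len r)%N;
  gram : 'M[int]_(\sum_r len r)%N;
  gram_sym : gram^T = gram;
  gram_even : forall x : 'rV_(\sum_r len r)%N,
    (2 %| (x *m gram *m x^T) 0%R 0%R)%Z;
  gram_pos : forall x : 'rV_(\sum_r len r)%N,
    x != 0 -> 0 < (x *m gram *m x^T) 0 0;
  gram_ge0 : forall i j, 0 <= gram i j;
  nu : 'S_(\sum_r len r)%N;
  nu_isometry : forall i j, gram (nu i) (nu j) = gram i j;
  nu_cycles : forall r (j : 'I_(len r)),
    nu (tagnat.Rank r j) = tagnat.Rank r (ordS j)
}.

Section Lattice.
Variable X : lattice_data.

Definition rk : nat := (\sum_r len (l := X) r)%N.
Definition ordnu : nat := #[nu X]%g.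
Definition kk : nat := (2 * ordnu)%N.

Definition lat : Type := 'rV[int]_rk.
HB.instance Definition _ := GRing.Zmodule.on lat.

Definition lform (a b : lat) : int := (a *m gram X *m b^T) 0 0.

Definition perm_row (T : Type) (s : 'S_rk) (a : 'rV[T]_rk) : 'rV[T]_rk :=
  \row_j a 0 (s^-1%g j).

(* nu^j and nu^(-j) *)
Definition nup (T : Type) (j : nat) (a : 'rV[T]_rk) := perm_row (nu X ^+ j)%g a.
Definition nun (T : Type) (j : nat) (a : 'rV[T]_rk) := perm_row (nu X ^- j)%g a.

Definition alpha (j : 'I_rk) : lat := delta_mx 0 j.
Definition first (r : 'I_(ncyc X)) : 'I_rk := tagnat.Rank r (Ordinal (len_gt0 r)).

Definition evenness (r : 'I_(ncyc X)) : bool :=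
  odd (len r) ||
  (2 %| lform (alpha (first r)) (nup (len r)./2 (alpha (first r))))%Z.

(* Sum of the coordinates of b along the r-th cycle of nu. *)
Definition charge (r : 'I_(ncyc X)) (b : lat) : int :=
  \sum_(j < len r) b 0 (tagnat.Rank r j).

(* The pair (s, a) is the element eta^s e_a of the central extension. The
   scalars below are powers of eta, written by their exponents modulo k; those
   of -1 and - eta^j are k/2 = ordnu and ordnu + j. *)
Definition lhat : Type := ('Z_kk * lat)%type.
HB.instance Definition _ := Choice.on lhat.

Definition sec (a : lat) : lhat := (0, a).

Definition eps (a b : lat) : 'Z_kk :=
  ordnu%:R *
  (\sum_(i < rk) \sum_(j < rk | (j < i)%N) a 0 i * b 0 j * gram X i j)%:~R.

Definition lhat_mul (x y : lhat) : lhat :=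
  (x.1 + y.1 + eps x.2 y.2, x.2 + y.2).

(* x * y = \prod_(0 < j < k/2) (- eta^j) ^ <nu^-j x, y> (x *_nu y) *)
Definition nu_twist (a b : lat) : 'Z_kk :=
  \sum_(1 <= j < ordnu) (ordnu + j)%:R * (lform (nun j a) b)%:~R.

Definition lhatnu_mul (x y : lhat) : lhat :=
  ((lhat_mul x y).1 - nu_twist x.2 y.2, x.2 + y.2).

Definition lhatnu_one : lhat := (0, 0).

Definition lhatnu_inv (x : lhat) : lhat :=
  (- x.1 - (eps x.2 (- x.2) - nu_twist x.2 (- x.2)), - x.2).

Definition is_nuhat (nuhat : lhat -> lhat) : Prop :=
  [/\ bijective nuhat,
      forall x y, nuhat (lhat_mul x y) = lhat_mul (nuhat x) (nuhat y),
      nuhat (1, 0) = (1, 0)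
    & forall j : 'I_rk, let r := tagnat.sig1 j in
      nuhat (sec (alpha j)) =
        (if evenness r then 0 else (kk %/ (2 * len r))%:R, nup 1 (alpha j))].

End Lattice.

Section Twisted.
Variables (C : fieldType) (X : lattice_data) (eta : C).

Local Notation lat := (lat X).
Local Notation lhat := (lhat X).
Local Notation k := (kk X).

Definition hh : lmodType C := 'rV[C]_(rk X).
Definition toh (a : lat) : hh := map_mx intr a.
Definition hform (g h : hh) : C := (g *m map_mx intr (gram X) *m h^T) 0 0.

Definition eigen (n : int) (h : hh) : Prop := nup 1 h = eta ^ n *: h.

(* The projection of h to the eigenspace h_(n). *)
Definition proj (n : int) (h : hh) : hh :=
  k%:R^-1 *: \sum_(j < k) eta ^ (- (n * j%:Z)) *: (nup j h : hh).

Definition latN (a : lat) : Prop := forall h, eigen 0 h -> hform (toh a) h = 0.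
Definition latM (a : lat) : Prop := exists b : lat, a = b - nup 1 b.
Definition comN (a b : lat) : C :=
  eta ^ (\sum_(j < k) j%:Z * lform (nup j a) b).
Definition latR (a : lat) : Prop :=
  latN a /\ (forall b, latN b -> comN a b = 1).

(* tau is defined on Nhat only: its values off Nhat are never used. *)
Definition is_tau (nuhat : lhat -> lhat) (tau : lhat -> C) : Prop :=
  [/\ forall x, latN x.2 -> tau x != 0,
      forall x y, latN x.2 -> latN y.2 ->
        tau (lhatnu_mul x y) = tau x * tau y,
      tau (1, 0) = eta
    & forall x : lhat, tau (lhatnu_mul x (lhatnu_inv (nuhat x))) =
        eta ^ (- ((\sum_(j < k) lform (nup j x.2) x.2) %/ 2)%Z)].

(* S[nu] = U(hhat[nu]) (x)_{U(hhat[nu]_{>= 0} + C k)} C with k = 1, presented by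
   the words in the letters (n, h), where (n, h) stands for h_(n) (x) t^(n/k). *)
Inductive S_rel : set {malg C[seq (int * hh)%type]} :=
| S_linear w w' n a (h h' : hh) : S_rel
    (<< 1 *g w ++ (n, a *: h + h') :: w' >>
     - a *: << 1 *g w ++ (n, h) :: w' >> - << 1 *g w ++ (n, h') :: w' >>)
| S_proj w w' n (h : hh) : S_rel
    (<< 1 *g w ++ (n, h) :: w' >> - << 1 *g w ++ (n, proj n h) :: w' >>)
| S_bracket w w' m n (g h : hh) : S_rel
    (<< 1 *g w ++ (m, g) :: (n, h) :: w' >>
     - << 1 *g w ++ (n, h) :: (m, g) :: w' >>
     - (if m + n == 0 then hform (proj m g) (proj n h) * (m%:~R / k%:R) else 0)
       *: << 1 *g w ++ w' >>)
| S_vacuum w n (h : hh) : 0 <= n -> S_rel << 1 *g rcons w (n, h) >>.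

Definition Snu : lmodType C := presented S_rel.

Definition S_mode (n : int) (h : hh) : Snu -> Snu :=
  plift (fun w => pgen S_rel ((n, h) :: w)).

Variable tau : lhat -> C.

(* U_T = C[Lhat_nu] (x)_{C[Nhat]} C_tau; the generator x is x (x) 1. *)
Inductive U_rel : set {malg C[lhat]} :=
| U_ind (x y : lhat) : latN y.2 -> U_rel
    (<< 1 *g lhatnu_mul x y >> - tau y *: << 1 *g x >>).

Definition UT : lmodType C := presented U_rel.

Definition U_act (x : lhat) : UT -> UT :=
  plift (fun y => pgen U_rel (lhatnu_mul x y)).

(* The coefficient of x^c in the operator x^h, for h in h_(0). *)
Definition U_xpow (h : hh) (c : C) : UT -> UT :=
  plift (fun y : lhat => if hform h (toh y.2) == c then pgen U_rel y else 0).

(* The factor \prod_j (- eta_(l_r)^j) ^ (- nu^j lambda^(r)) of Delta^T. As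
   (e^alpha)_m raises the degree in L by alpha, this is the scalar
   (-1) ^ #{p : i_p = r} on a monomial in the operators (e^alpha^(i_p))_(n_p)
   applied to 1_T. The charge vanishes on N, so it depends only on the class in
   L/N; the exponents <nu^j lambda^(r), y> do not. *)
Definition U_sign (r : 'I_(ncyc X)) : UT -> UT :=
  plift (fun y : lhat => (-1) ^ charge r y.2 *: pgen U_rel y).

Definition VLT : lmodType C := tensor Snu UT.

Definition vac : VLT := tens (pgen S_rel [::]) (pgen U_rel (lhatnu_one X)).

Definition hmode (n : int) (h : hh) : VLT -> VLT := tensor_map (S_mode n h) id.
Definition lact (x : lhat) : VLT -> VLT := tensor_map id (U_act x).
Definition xpow (h : hh) (c : C) : VLT -> VLT := tensor_map id (U_xpow h c).
Definition sgn (r : 'I_(ncyc X)) : VLT -> VLT := tensor_map id (U_sign r).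

(* Coefficient of x^(- q/k) in E^+(- h, x). *)
Definition Eplus (h : hh) : nat -> VLT -> VLT :=
  exp_coef (fun n v => - (n%:R / k%:R)^-1 *: hmode n%:Z h v).

(* Coefficient of x^(p/k) in E^-(- h, x). *)
Definition Eminus (h : hh) : nat -> VLT -> VLT :=
  exp_coef (fun n v => - (- (n%:R / k%:R))^-1 *: hmode (- n%:Z) h v).

Definition sigma (a : lat) : C :=
  (\prod_(1 <= j < k./2) (1 - eta ^ (- j%:Z)) ^ lform (nup j a) a) *
  2 ^ (lform (nup k./2 a) a %/ 2)%Z.

(* Coefficient of x^e in Y(e^a, x); the terms are p/k from E^-, - q/k from E^+
   and the rest from the power of x. The sum is locally finite. *)
Definition Ycoef (a : lat) (e : C) (v : VLT) : VLT :=
  let a0 := proj 0 (toh a) in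
  let e0 := hform a0 a0 / 2 - (lform a a)%:~R / 2 in
  (k%:R ^ (- (lform a a %/ 2)%Z) * sigma a) *:
  \sum_(pq \in [set: nat * nat])
    Eminus (toh a) pq.1 (Eplus (toh a) pq.2 (lact (sec a)
      (xpow a0 (e - e0 - pq.1%:R / k%:R + pq.2%:R / k%:R) v))).

(* (e^a)_(m/k) *)
Definition emode (a : lat) (m : int) : VLT -> VLT :=
  Ycoef a (- (m%:~R / k%:R) - (lform a a)%:~R / 2).

Definition WLT : set VLT :=
  lspan [set v | exists s : seq ('I_(rk X) * int),
                   v = foldr (fun p => emode (alpha p.1) p.2) vac s].

(* The basis of h dual to the alpha j. *)
Definition lambda (j : 'I_(rk X)) : hh := row j (invmx (map_mx intr (gram X))).

(* Coefficient of x^e in Delta^T(lambda^(r), - x). *)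
Definition Delta_coef (r : 'I_(ncyc X)) (e : C) (v : VLT) : VLT :=
  let l := lambda (first r) in
  \sum_(q \in [set: nat])
    sgn r (xpow (proj 0 l) (e + q%:R / k%:R) (Eplus l q v)).

Definition Delta_c (r : 'I_(ncyc X)) : VLT -> VLT := Delta_coef r 0.

End Twisted.

Arguments vac {C X} eta tau.
Arguments hmode {C X} eta tau n h v : rename.
Arguments lact {C X} eta tau x v : rename.
Arguments xpow {C X} eta tau h c v : rename.
Arguments sgn {C X} eta tau r v : rename.
Arguments Ycoef {C X} eta tau a e v.
Arguments emode {C X} eta tau a m v : rename.
Arguments WLT {C X} eta tau v : rename.
Arguments Delta_coef {C X} eta tau r e v.
Arguments Delta_c {C X} eta tau r v : rename.

(* Main.v *)
From HB Require Import structures.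
Require Import Defs.
From mathcomp Require Import all_boot all_order all_algebra.
From mathcomp Require Import fingroup perm generic_quotient ring_quotient.
From mathcomp Require Import finmap boolp classical_sets cardinality fsbigop.
From mathcomp Require Import reals complex.
From mathcomp Require Import monalg zify ring.

(* Put h_(i,p) for the coefficient of x^(p / l_i) in E^-(- alpha^(i), x). Then
   W_L^T is the span of the vectors
     h_(i_1,p_1) .. h_(i_s,p_s) 1 (x) e_(alpha^(i_1) + .. + alpha^(i_s)) 1
   with all p_j >= 0, where h_(i,0) = 1. Indeed E^+ lowers the degree, so when a
   mode of Y(e^alpha^(i), x) is applied to such a vector one can solve for the
   creation part by induction on the degree.
   On these vectors e_(alpha^(i)) appends a factor h_(i,0). As
     E^+(- lambda^(i), x) E^-(- alpha^(j), y) =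
       (1 - (y / x)^(1 / l_i))^(delta_ij)
         E^-(- alpha^(j), y) E^+(- lambda^(i), x),
   the constant term of Delta^T(lambda^(i), - x) lowers the second index of
   every factor h_(i,p) by 1 and kills the vectors with a factor h_(i,0). It
   remains to see that the products h_(i_1,p_1) .. h_(i_s,p_s) 1, for a fixed
   multiset of the i_j, are linearly independent; the same lowering operators
   show this by induction on the number of factors and the degree, since 1 is
   not 0 in S[nu]. *)

Set Implicit Arguments.
Unset Strict Implicit.
Unset Printing Implicit Defensive.

Import Order.TTheory GRing.Theory Num.Theory.
Local Open Scope classical_set_scope.
Local Open Scope ring_scope.
Local Open Scope quotient_scope.

(** * Linear maps, spans and presented modules *)

(** All modules here are given by generators and relations, so the main obstacle is to show that
    something does not vanish. For S[nu] this is done by the vacuum expectation, defined on words by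
    Wick's formula and checked against the relations; for U_T by one coordinate functional for each
    coset of N, built from tau. The latter also separate monomials with different multisets of the
    i_j: since N = M, the sum of the coordinates along a cycle vanishes on N, so the coset
    determines the multiset. The commutation factor comes from the pairing of lambda^(i) with the
    projection of alpha^(j) to h_(-n). It is 1 / l_i if i = j and k / l_i divides n, and 0
    otherwise, which makes the exponent of the factor the logarithm of 1 - (y / x)^(1 / l_i).
    Operator exponentials are compared through y d/dy exp A = (y A') exp A, which determines the
    coefficients in characteristic 0. The modes and Delta^T are sums over infinite index sets. Their
    finiteness, and with it linearity, is established on the span of the monomials; for this reason
    the abstract part assumes linearity only there. *)

Section LinearMaps.
Variables (C : fieldType) (V W : lmodType C).
Implicit Types f : V -> W.

Lemma linP f a x y : linear f -> f (a *: x + y) = a *: f x + f y.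
Proof. exact. Qed.

Lemma lin0 f : linear f -> f 0 = 0.
Proof. by move=> fL; have := fL (-1) 0 0;
  rewrite scaler0 addr0 scaleN1r addNr. Qed.

Lemma linD f x y : linear f -> f (x + y) = f x + f y.
Proof. by move=> fL; have := fL 1 x y; rewrite !scale1r. Qed.

Lemma linZ f a x : linear f -> f (a *: x) = a *: f x.
Proof. by move=> fL; have := fL a x 0; rewrite (lin0 fL) !addr0. Qed.

Lemma linB f x y : linear f -> f (x - y) = f x - f y.
Proof. by move=> fL; rewrite linD // -scaleN1r linZ // scaleN1r. Qed.

Lemma lin_sum f I (r : seq I) (P : pred I) (F : I -> V) : linear f ->
  f (\sum_(i <- r | P i) F i) = \sum_(i <- r | P i) f (F i).
Proof.
move=> fL; elim/big_rec2: _ => [|i y z _ <-]; first exact: lin0.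
exact: linD.
Qed.

End LinearMaps.

Lemma lin_comp (C : fieldType) (U V W : lmodType C) (g : V -> W) (f : U -> V) :
  linear g -> linear f -> linear (fun x => g (f x)).
Proof. by move=> gL fL a x y; rewrite fL gL. Qed.

Section Spans.
Variable C : fieldType.

Lemma lspan_ge (V : lmodType C) (P : set V) x : P x -> lspan P x.
Proof.
move=> Px; exists [:: (1, x)]; last by rewrite big_seq1 scale1r.
by move=> p; rewrite inE => /eqP->.
Qed.

Lemma lspan_sum (V : lmodType C) (P : set V) I (r : seq I) (Q : pred I)
    (F : I -> V) :
  (forall i, Q i -> lspan P (F i)) -> lspan P (\sum_(i <- r | Q i) F i).
Proof. by move=> FP; elim/big_rec: _ => [|i x Qi];
  [exact: lspan0|exact/lspanD/FP]. Qed.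

Lemma lspan_ind (V : lmodType C) (P Q : set V) : Q 0 ->
  (forall a x y, P x -> Q y -> Q (a *: x + y)) -> forall x, lspan P x -> Q x.
Proof.
move=> Q0 QD x [s sP ->]; elim: s sP => [|p s IH] sP; first by rewrite big_nil.
rewrite big_cons; apply: QD; first by apply: sP; rewrite mem_head.
by apply: IH => q qs; apply: sP; rewrite inE qs orbT.
Qed.

Lemma lspan_min (V : lmodType C) (P Q : set V) :
  (forall x, P x -> lspan Q x) -> forall x, lspan P x -> lspan Q x.
Proof.
move=> PQ; apply: lspan_ind => [|a x y /PQ Px Qy]; first exact: lspan0.
by apply: lspanD => //; apply: lspanZ.
Qed.

Lemma lspan_lin (V W : lmodType C) (P : set V) (Q : set W) f :
  linear f -> (forall x, P x -> lspan Q (f x)) -> forall x, lspan P x ->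
    lspan Q (f x).
Proof.
move=> fL PQ; apply: lspan_ind => [|a x y /PQ Px Qy]; first by rewrite lin0 //;
  exact: lspan0.
by rewrite fL; apply: lspanD => //; apply: lspanZ.
Qed.

End Spans.

(** * Linear maps out of a module given by generators and relations *)

Section PresentedTheory.
Variables (C : fieldType) (K : choiceType).

Lemma malgUZ (a : C) (k : K) : << a *g k >> = a *: << 1 *g k >> :> {malg C[K]}.
Proof. by apply/malgP => k'; rewrite mcoeffZ !mcoeffU mulrnAr mulr1. Qed.

Definition mlin (W : lmodType C) (f : K -> W) (x : {malg C[K]}) : W :=
  \sum_(k <- msupp x) x@_k *: f k.

Lemma mlinE (W : lmodType C) (f : K -> W) (x : {malg C[K]}) (d : {fset K}) :
  (msupp x `<=` d)%fset -> mlin f x = \sum_(k <- d) x@_k *: f k.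
Proof.
move=> sub; rewrite /mlin (big_fset_incl _ sub) // => k _.
by move/mcoeff_outdom=> ->; rewrite scale0r.
Qed.

Lemma mlin_linear (W : lmodType C) (f : K -> W) : linear (mlin f).
Proof.
move=> a x y; set d := (msupp x `|` msupp y)%fset.
have dx : (msupp x `<=` d)%fset by apply: fsubsetUl.
have dy : (msupp y `<=` d)%fset by apply: fsubsetUr.
have dz : (msupp (a *: x + y) `<=` d)%fset.
  apply: fsubset_trans (msuppD_le _ _) _.
  by rewrite fsubUset dy andbT; apply: fsubset_trans (msuppZ_le _ _) dx.
rewrite (mlinE f dx) (mlinE f dy) (mlinE f dz) scaler_sumr -big_split /=.
by apply: eq_bigr => k _; rewrite mcoeffD mcoeffZ scalerDl scalerA.
Qed.

Lemma mlinU (W : lmodType C) (f : K -> W) a k : mlin f << a *g k >> = a *: f k.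
Proof. by rewrite (mlinE f msuppU_le) big_seq_fset1 mcoeffUU. Qed.

Section MlinWords.
Variables (W : lmodType C) (f : K -> W).
Implicit Types (a : C) (w : K).

Lemma mlin_gen w : mlin f << 1 *g w >> = f w.
Proof. by rewrite mlinU scale1r. Qed.

Lemma mlin_genB w1 w2 : mlin f (<< 1 *g w1 >> - << 1 *g w2 >>) = f w1 - f w2.
Proof. by rewrite (linB _ _ (mlin_linear f)) !mlin_gen. Qed.

Lemma mlin_genBZ w1 a w2 :
  mlin f (<< 1 *g w1 >> - a *: << 1 *g w2 >>) = f w1 - a *: f w2.
Proof.
by rewrite (linB _ _ (mlin_linear f)) (linZ a _ (mlin_linear f)) !mlin_gen.
Qed.

Lemma mlin_genBZB w1 a w2 w3 :
  mlin f (<< 1 *g w1 >> - a *: << 1 *g w2 >> - << 1 *g w3 >>)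
    = f w1 - a *: f w2 - f w3.
Proof. by rewrite (linB _ _ (mlin_linear f)) mlin_genBZ mlin_gen. Qed.

Lemma mlin_genBBZ w1 w2 a w3 :
  mlin f (<< 1 *g w1 >> - << 1 *g w2 >> - a *: << 1 *g w3 >>)
    = f w1 - f w2 - a *: f w3.
Proof.
by rewrite (linB _ _ (mlin_linear f)) (linZ a _ (mlin_linear f)) mlin_genB
  mlin_gen.
Qed.

End MlinWords.

Variable rel : set {malg C[K]}.
Local Notation Q := (Quotient.quot (relspan rel)).

Lemma ppiD (x y : {malg C[K]}) :
  \pi_Q (x + y) = \pi_Q x + \pi_Q y :> presented rel.
Proof. exact: raddfD. Qed.

Lemma pi_linear : linear (\pi_Q : _ -> presented rel).
Proof. by move=> a x y; rewrite ppiD -pi_pscale. Qed.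

Variables (W : lmodType C) (f : K -> W).
Hypothesis f_rel : forall x, rel x -> mlin f x = 0.

Lemma plift_pi (x : {malg C[K]}) : plift f (\pi_Q x : presented rel) = mlin f x.
Proof.
rewrite -[LHS]/(mlin f (repr (\pi_Q x))); apply/subr0_eq.
have fL := mlin_linear f.
rewrite -(linB _ _ fL).
have : repr (\pi_Q x) - x \in relspan rel by rewrite Quotient.idealrBE reprK.
rewrite unfold_in => /asboolP; move: (_ - _) => z.
move: z; apply: lspan_ind => [|a y z /f_rel fy fz]; first by rewrite lin0.
by rewrite fL fy fz scaler0 addr0.
Qed.

Lemma plift_linear : linear (plift f : presented rel -> W).
Proof.
move=> a x y; rewrite -[x]reprK -[y]reprK.
by rewrite -[_ + _]pi_linear !plift_pi mlin_linear.
Qed.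

Lemma plift_gen k : plift f (pgen rel k) = f k.
Proof. by rewrite /pgen plift_pi mlinU scale1r. Qed.

End PresentedTheory.

Section PresentedSpan.
Variables (C : fieldType) (K : choiceType) (rel : set {malg C[K]}).

(** The linear extension of [pgen] is the quotient map itself, so each defining relation becomes an
    identity between generators. *)
Lemma pgen_rel x : rel x -> mlin (pgen rel) x = 0.
Proof.
move=> relx.
have -> : mlin (pgen rel) x =
  (\pi_(Quotient.quot (relspan rel)) x : presented rel).
  rewrite [in RHS](monalgE x) (lin_sum _ _ _ (pi_linear rel)).
  apply: eq_bigr => k _; rewrite -[_ *: _](linZ _ _ (pi_linear rel)).
  by rewrite -malgUZ.
apply/eqP; rewrite -[0](lin0 (pi_linear rel)) -Quotient.idealrBE subr0
  unfold_in.
exact/asboolP/lspan_ge.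
Qed.

Lemma presented_span (x : presented rel) : lspan (range (pgen rel)) x.
Proof.
rewrite -[x]reprK [repr x]monalgE (lin_sum _ _ _ (pi_linear rel)).
apply: lspan_sum => k _.
rewrite malgUZ (linZ _ _ (pi_linear rel)).
by apply: lspanZ; apply: lspan_ge; exists k.
Qed.

Lemma presented_lin_eq (W : lmodType C) (f g : presented rel -> W) :
  linear f -> linear g -> (forall k, f (pgen rel k) = g (pgen rel k)) -> f =1 g.
Proof.
move=> fL gL fg x; have : lspan (range (pgen rel)) x by apply: presented_span.
move: x; apply: lspan_ind => [|a _ y [k _ <-] IH]; first by rewrite !lin0.
by rewrite fL gL fg IH.
Qed.

End PresentedSpan.

(** * Exponentials of commuting operators *)

(* The value 0 at negative indices frees the recursions below of side
   conditions. *)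
Definition expz (C : fieldType) (V : lmodType C) (c : nat -> V -> V) (z : int)
    (v : V) : V :=
  if z is Posz q then exp_coef c q v else 0.

Lemma expz_neg (C : fieldType) (V : lmodType C) (c : nat -> V -> V) z v :
  z < 0 -> expz c z v = 0.
Proof. by case: z. Qed.

Lemma exp_coef_map (C : fieldType) (V W : lmodType C) (c : nat -> V -> V)
    (c' : nat -> W -> W) (f : V -> W) q v :
  linear f -> (forall n w, f (c n w) = c' n (f w)) ->
  f (exp_coef c q v) = exp_coef c' q (f v).
Proof.
move=> fL fc; rewrite /exp_coef lin_sum //; apply: eq_bigr => m _.
rewrite linZ // lin_sum //; congr (_ *: _); apply: eq_bigr => t _.
by elim: (tval t) => //= n s <-.
Qed.

Lemma expz_map (C : fieldType) (V W : lmodType C) (c : nat -> V -> V)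
    (c' : nat -> W -> W) (f : V -> W) z v :
  linear f -> (forall n w, f (c n w) = c' n (f w)) ->
  f (expz c z v) = expz c' z (f v).
Proof. by case: z => q fL fc /=; [exact: exp_coef_map|rewrite lin0]. Qed.

Lemma exp_coef_linear (C : fieldType) (V : lmodType C) (c : nat -> V -> V) q :
  (forall n, linear (c n)) -> linear (exp_coef c q).
Proof.
move=> cL a x y; rewrite /exp_coef scaler_sumr -big_split /=.
apply: eq_bigr => m _; rewrite scalerA mulrC -scalerA -scalerDr; congr (_ *: _).
rewrite scaler_sumr -big_split /=; apply: eq_bigr => t _.
by elim: (tval t) => [|n s IH]; rewrite /= ?IH ?cL.
Qed.

Section Exponential.
Variables (C : numFieldType) (V : lmodType C) (c : nat -> V -> V).
Hypothesis cL : forall n, linear (c n).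
Hypothesis c0 : forall v, c 0 v = 0.

(* The coefficient of [y^z] in the [m]-th power of [\sum_(n < N) c n y^n]. *)
Fixpoint pow_coef N m (z : int) v : V :=
  if m is m'.+1 then \sum_(n < N) c n (pow_coef N m' (z - n%:Z) v)
  else if z == 0 then v else 0.

(** The tuples in [exp_coef] are enumerated by their first entry. They exclude the entry 0, which
    [pow_coef] allows; this makes no difference because [c 0] vanishes. *)
Lemma pow_coef_tuple N m (z : int) v :
  \sum_(t : m.-tuple 'I_N |
            all (fun n : 'I_N => (0 < n)%N) t &&
            ((\sum_(n <- t) (n : nat))%N%:Z == z))
      foldr (fun (n : 'I_N) w => c n w) v t = pow_coef N m z v.
Proof.
elim: m z => [|m IH] z /=.
  case: eqP => [->|zN0].
    rewrite (big_pred1 [tuple]) // => t.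
    by rewrite [t]tuple0 /= big_nil !eqxx.
  by rewrite big_pred0 // => t; rewrite [t]tuple0 /= big_nil eq_sym; apply/eqP.
rewrite (reindex (fun p : 'I_N * m.-tuple 'I_N => [tuple of p.1 :: p.2])) /=;
  last first.
  exists (fun t => (thead t, [tuple of behead t])) => [[n t] _|t _] /=.
    by congr (_, _); apply/val_inj.
  by rewrite -tuple_eta.
under eq_bigl do rewrite big_cons PoszD.
rewrite -(pair_big_dep xpredT (fun (n : 'I_N) (t : m.-tuple 'I_N) =>
   ((0 < n)%N && all (fun n : 'I_N => (0 < n)%N) t) &&
     (n%:Z + (\sum_(n <- t) (n : nat))%N%:Z == z)) (fun n t =>
   c n (foldr (fun (n : 'I_N) w => c n w) v t))) /=.
apply: eq_bigr => n _; have [->|n0] := posnP n.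
  by rewrite c0 big_pred0.
rewrite -IH lin_sum //; apply: eq_bigl => t /=; congr (_ && _).
by apply/eqP/eqP => [<-|->]; ring.
Qed.

Lemma pow_coef_lt N m (z : int) v : z < m%:Z -> pow_coef N m z v = 0.
Proof.
elim: m z => [|m IH] z zm /=; first by case: eqP zm => // ->; rewrite ltxx.
apply: big1 => -[[|n] nN] _ /=; first exact: c0.
by rewrite IH ?lin0 //; lia.
Qed.

Lemma pow_coef_bound N N' m (z : int) v : z < N%:Z -> z < N'%:Z ->
  pow_coef N m z v = pow_coef N' m z v.
Proof.
wlog le : N N' / (N <= N')%N => [wl zN zN'|].
  by case/orP: (leq_total N N') => ?; [|apply/esym]; apply: wl.
elim: m z => //= m IH z zN zN'.
rewrite (big_ord_widen _ (fun n => c n (pow_coef N m (z - n%:Z) v)) le).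
rewrite [RHS](bigID (fun n : 'I_N' => (n < N)%N)) /= [X in _ + X]big1 ?addr0.
  by apply: eq_bigr => n _; rewrite IH //; lia.
by move=> n; rewrite -leqNgt => Nn; rewrite pow_coef_lt ?lin0 //; lia.
Qed.

(** Both cut-offs can be raised at will: the m-th power starts in degree m, and a factor of degree
    above z cannot contribute. Recursions can thus be proved under one common bound. *)
Lemma expzE N M (z : int) v : z < N%:Z -> z < M%:Z ->
  expz c z v = \sum_(m < M) (m`!%:R)^-1 *: pow_coef N m z v.
Proof.
case: z => [q|q] qN qM /=; last first.
  by rewrite big1 // => m _; rewrite pow_coef_lt ?scaler0 //; lia.
have le : (q.+1 <= M)%N by lia.
rewrite /exp_coef (bigID (fun m : 'I_M => (m < q.+1)%N)) /= [X in _ = _ + X]big1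
  ?addr0.
  rewrite -(big_ord_widen _ (fun m => (m`!%:R)^-1 *: pow_coef N m q v) le).
  apply: eq_bigr => m _; congr (_ *: _).
  rewrite (@pow_coef_bound N q.+1) ?ltz_nat // -pow_coef_tuple.
  by apply: eq_bigl => t; rewrite eqz_nat.
by move=> m; rewrite -leqNgt => qm; rewrite pow_coef_lt ?scaler0 //; lia.
Qed.

Lemma expz0 v : expz c 0 v = v.
Proof. by rewrite (@expzE 1 1) // big_ord1 /= invr1 scale1r. Qed.

(** Read on coefficients, y d/dy exp A = (y A') exp A determines all of them from the constant term,
    since q + 1 is invertible. This is how a series is recognised as an exponential. *)
Lemma expz_uniq (F : int -> V) v (z : int) :
  (forall z : int, z < 0 -> F z = 0) -> F 0 = v ->
  (forall q, q.+1%:R *: F q.+1%:Z =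
    \sum_(n < q.+2) n%:R *: c n (F (q.+1%:Z - n%:Z))) ->
  (forall q, q.+1%:R *: expz c q.+1%:Z v
     = \sum_(n < q.+2) n%:R *: c n (expz c (q.+1%:Z - n%:Z) v)) ->
  F z = expz c z v.
Proof.
move=> FN F0 Fr Er; case: z => [q|q]; last by rewrite FN.
have [m] := ubnP q; elim: m q => // m IH [|q] qm; first by rewrite F0 expz0.
apply: (@scalerI _ _ q.+1%:R); first by rewrite pnatr_eq0.
rewrite Fr Er; apply: eq_bigr => -[[|n] nq] _ /=; first by rewrite !scale0r.
congr (_ *: c _ _); have -> : q.+1%:Z - n.+1%:Z = (q - n)%N by lia.
by apply: IH; lia.
Qed.

Hypothesis cC : forall m n v, c m (c n v) = c n (c m v).

(** Coefficientwise, y d/dy A^(m+1) = (m + 1) (y A') A^m, valid as the coefficients of A commute. *)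
Lemma pow_coef_rec N m (z : int) v : z%:~R *: pow_coef N m.+1 z v =
  m.+1%:R *: \sum_(n < N) n%:R *: c n (pow_coef N m (z - n%:Z) v).
Proof.
elim: m z => [|m IH] z.
  rewrite scale1r /= scaler_sumr; apply: eq_bigr => n _.
  rewrite subr_eq0; case: eqP => [->|_]; first by rewrite pmulrn.
  by rewrite lin0 // !scaler0.
(* The Leibniz rule: z is split into n, for the outer factor, and z - n, for the remaining power. *)
have step (n : nat) : z%:~R *: c n (pow_coef N m.+1 (z - n%:Z) v) =
    n%:R *: c n (pow_coef N m.+1 (z - n%:Z) v) +
    m.+1%:R *: \sum_(i < N) i%:R *: c i
      (c n (pow_coef N m (z - i%:Z - n%:Z) v)).
  have -> : z%:~R = n%:R + (z - n%:Z)%:~R :> C by rewrite pmulrn -intrD subrKC.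
  rewrite scalerDl; congr (_ + _); rewrite -linZ // IH linZ // lin_sum //.
  congr (_ *: _); apply: eq_bigr => i _; rewrite linZ // cC.
  by congr (_ *: c _ (c _ (pow_coef _ _ _ _))); ring.
have -> : pow_coef N m.+2 z v =
  \sum_(n < N) c n (pow_coef N m.+1 (z - n%:Z) v) by [].
rewrite scaler_sumr (eq_bigr _ (fun (n : 'I_N) _ => step n)) big_split /=.
rewrite -scaler_sumr exchange_big /= -[m.+2]add1n natrD scalerDl scale1r;
  congr (_ + _ *: _).
by apply: eq_bigr => i _; rewrite -scaler_sumr (lin_sum _ _ _ (cL i)).
Qed.

Lemma expz_rec N (z : int) v : z < N%:Z ->
  z%:~R *: expz c z v = \sum_(n < N) n%:R *: c n (expz c (z - n%:Z) v).
Proof.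
move=> zN; rewrite (@expzE N N.+1 z) ?scaler_sumr; [|lia..].
rewrite big_ord_recl /= fact0 invr1 scale1r.
have -> : z%:~R *: (if z == 0 then v else 0) = 0.
  by case: eqP => [->|_]; rewrite ?scale0r ?scaler0.
rewrite add0r.
have step (m : nat) : z%:~R *: ((m.+1`!)%:R^-1 *: pow_coef N m.+1 z v) =
    \sum_(n < N) n%:R *: c n ((m`!)%:R^-1 *: pow_coef N m (z - n%:Z) v).
  rewrite scalerA mulrC -scalerA pow_coef_rec scalerA factS natrM invfM mulrAC.
  rewrite mulVf ?pnatr_eq0 // mul1r scaler_sumr; apply: eq_bigr => n _.
  by rewrite (linZ _ _ (cL n)) !scalerA mulrC.
rewrite (eq_bigr _ (fun (m : 'I_N) _ => step m)) exchange_big /=.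
apply: eq_bigr => n _; rewrite -scaler_sumr (@expzE N N); [|lia..].
by rewrite (lin_sum _ _ _ (cL n)).
Qed.

Lemma expz_recS q v : q.+1%:R *: expz c q.+1%:Z v
     = \sum_(n < q.+2) n%:R *: c n (expz c (q.+1%:Z - n%:Z) v).
Proof. by rewrite -(@expz_rec q.+2) ?pmulrn //; lia. Qed.

Lemma expz_linear z : linear (expz c z).
Proof.
case: z => q; first exact: exp_coef_linear.
by move=> a x y; rewrite /= scaler0 addr0.
Qed.

End Exponential.

Section Scaling.
Variables (C : numFieldType) (V : lmodType C) (c c' : nat -> V -> V).
Hypothesis cL : forall n, linear (c n).
Hypothesis cL' : forall n, linear (c' n).
Hypothesis c0 : forall v, c 0 v = 0.
Hypothesis cC : forall m n v, c m (c n v) = c n (c m v).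
Hypothesis cC' : forall m n v, c' m (c' n v) = c' n (c' m v).

(** The substitution of u y for y commutes with the exponential. *)
Lemma expz_scale (u : C) (z : int) v :
  u != 0 -> (forall n v, c' n v = u ^+ n *: c n v) -> expz c' z v =
    u ^ z *: expz c z v.
Proof.
move=> u0 c'E; have c0' w : c' 0 w = 0 by rewrite c'E c0 scaler0.
apply/esym; apply: (@expz_uniq _ _ c' cL' c0' (fun z => u ^ z *: expz c z v)) =>
  [[]//q _||q|q].
- by rewrite scaler0.
- by rewrite expz0 // scale1r.
- rewrite scalerA mulrC -scalerA expz_recS // scaler_sumr.
  apply: eq_bigr => n _; rewrite (linZ _ _ (cL' n)) c'E !scalerA;
    congr (_ *: _).
  rewrite mulrC -mulrA -[u ^+ n]/(u ^ n%:Z) -expfzDr //.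
  by congr (_ * (u ^ _)); ring.
- exact: expz_recS.
Qed.

(** In the recursion a term survives only if s divides both n and q - n, hence q. *)
Lemma expz_step (s q : nat) v : (forall n v, ~~ (s %| n)%N -> c n v = 0) ->
  ~~ (s %| q)%N -> expz c q v = 0.
Proof.
move=> cs; have [m] := ubnP q; elim: m q => // m IH [|q] qm sq.
  by rewrite dvdn0 in sq.
apply: (@scalerI _ _ q.+1%:R); first by rewrite pnatr_eq0.
rewrite expz_recS // scaler0 big1 // => -[[|n] nq] _ /=;
  first by rewrite scale0r.
have [sn|sn] := boolP (s %| n.+1)%N; last by rewrite cs ?scaler0.
have -> : q.+1%:Z - n.+1%:Z = (q - n)%N by lia.
have qnm : (q - n < m)%N by clear -nq qm; lia.
have sqn : ~~ (s %| q - n)%N.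
  by apply: contra sq => sqn; rewrite -(@subnK n.+1 q.+1) // subSS dvdn_add.
by rewrite (IH _ qnm sqn) (lin0 (cL _)) scaler0.
Qed.

End Scaling.

(** The substitution s = r + n; the two vanishing conditions discard the terms that leave the common
    range. *)
Lemma big_ord_shift (V : zmodType) (M n : nat) (F : int -> int -> V) :
  (forall s t : int, s < 0 -> F s t = 0) ->
    (forall s t : int, M%:Z <= t -> F s t = 0) ->
  \sum_(r < M) F r%:Z (r%:Z + n%:Z) = \sum_(s < M) F (s%:Z - n%:Z) s%:Z.
Proof.
move=> Fneg Fbig.
have -> : \sum_(s < M) F (s%:Z - n%:Z) s%:Z =
  \sum_(0 <= s < M + n) F (s%:Z - n%:Z) s%:Z.
  rewrite (big_cat_nat (n := M)) ?leq_addr //= big_mkord.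
  rewrite [X in _ = _ + X]big_nat_cond [X in _ = _ + X]big1 ?addr0 // => s.
  by move=> /andP[/andP[Ms _] _]; apply: Fbig; rewrite lez_nat.
rewrite (big_cat_nat (n := n)) ?leq_addl //=.
rewrite [X in _ = X + _]big_nat_cond [X in _ = X + _]big1 ?add0r => [|s].
  rewrite -{2}[n]add0n big_addn addnK big_mkord; apply: eq_bigr => r _.
  by rewrite PoszD addrK.
by move=> /andP[/andP[_ sn] _]; apply: Fneg; rewrite subr_lt0 ltz_nat.
Qed.

(** * Commuting two exponentials past each other *)

Section Heisenberg.
Variables (C : numFieldType) (V : lmodType C) (cp cm : nat -> V -> V)
  (a : nat -> C).
Hypothesis cpL : forall n, linear (cp n).
Hypothesis cmL : forall n, linear (cm n).
Hypothesis cp0 : forall v, cp 0 v = 0.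
Hypothesis cm0 : forall v, cm 0 v = 0.
Hypothesis cpC : forall m n v, cp m (cp n v) = cp n (cp m v).
Hypothesis cmC : forall m n v, cm m (cm n v) = cm n (cm m v).
Hypothesis cpm : forall m n v,
  cp m (cm n v) = cm n (cp m v) + (if m == n then a n else 0) *: v.
Hypothesis a0 : a 0 = 0.

(** With B(y) the sum of the [cm n] y^n, the commutator of [cp m] with B(y) is the scalar a_m y^m,
    so [cp m, exp B(y)] = a_m y^m exp B(y). *)
Lemma annihilate_exp m (z : int) v :
  cp m (expz cm z v) = expz cm z (cp m v) + a m *: expz cm (z - m%:Z) v.
Proof.
case: z => [q|q]; last first.
  rewrite !expz_neg ?(lin0 (cpL m)) ?scaler0 ?addr0 //; lia.
have [b] := ubnP q; elim: b q => // b IH [|q] qb.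
  rewrite !expz0 // sub0r; case: m {IH} => [|m].
    by rewrite a0 scale0r addr0.
  by rewrite expz_neg ?scaler0 ?addr0 //; lia.
apply: (@scalerI _ _ q.+1%:R); first by rewrite pnatr_eq0.
rewrite -(linZ _ _ (cpL m)) expz_recS // (lin_sum _ _ _ (cpL m)).
pose E := expz cm.
have step (n : 'I_q.+2) : cp m (n%:R *: cm n (E (q.+1%:Z - n%:Z) v)) =
  (n%:R *: cm n (E (q.+1%:Z - n%:Z) (cp m v))
   + a m *: (n%:R *: cm n (E (q.+1%:Z - m%:Z - n%:Z) v)))
  + (if m == n then n%:R * a n else 0) *: E (q.+1%:Z - m%:Z) v.
  case: n => -[|n] nq /=.
    by rewrite !scale0r mul0r if_same scale0r scaler0 !addr0 (lin0 (cpL m)).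
  rewrite (linZ _ _ (cpL m)) cpm.
  have -> : q.+1%:Z - n.+1%:Z = (q - n)%N by clear -nq; lia.
  rewrite IH; last by clear -nq qb; lia.
  rewrite (linD _ _ (cmL _)) (linZ _ _ (cmL _)) !scalerDr.
  have -> : (q - n)%N%:Z - m%:Z = q.+1%:Z - m%:Z - n.+1%:Z by clear -nq; lia.
  congr (_ + _ + _); first by rewrite !scalerA mulrC.
  case: eqP => [->|_]; last by rewrite !scale0r scaler0.
  rewrite scalerA; congr (_ *: E _ v); clear -nq; lia.
rewrite (eq_bigr _ (fun n _ => step n)) !big_split /= -/E -expz_recS //.
rewrite -scaler_sumr -(@expz_rec _ _ _ cmL cm0 cmC); last by lia.
rewrite -scaler_suml -addrA scalerDr; congr (_ + _).
rewrite !scalerA -scalerDl mulrC; case: (ltnP m q.+2) => mq.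
  rewrite (bigD1 (Ordinal mq)) //= eqxx big1 ?addr0; last first.
    by move=> n; rewrite -val_eqE /= eq_sym => /negbTE->.
  (* The part q + 1 - m comes from the recursion at the lowered index, the part m from the single
     term n = m with a nonzero commutator. *)
  congr (_ *: _); have -> : q.+1%:R = (q.+1%:Z - m%:Z)%:~R + m%:R :> C.
    by rewrite [m%:R]pmulrn -intrD subrK.
  by ring.
by rewrite /E expz_neg ?scaler0 //; lia.
Qed.

Variable e : int -> C.
Hypothesis e_neg : forall z : int, z < 0 -> e z = 0.
Hypothesis e0 : e 0 = 1.
Hypothesis e_rec : forall N (z : int), z < N%:Z ->
  z%:~R * e z = \sum_(n < N) n%:R * a n * e (z - n%:Z).

(** For a scalar commutator, exp A exp B = exp [A, B] exp B exp A. The coefficients [e] of exp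
    [A, B] enter only through their recursion, so that a closed form can be inserted later. The
    right-hand side is shown to satisfy the recursion of exp A in the index z. *)
Lemma exp_exp (p : nat) (z : int) v :
  expz cp z (expz cm p v) =
  \sum_(r < p.+1) e r%:Z *: expz cm (p%:Z - r%:Z) (expz cp (z - r%:Z) v).
Proof.
pose F (z : int) := \sum_(r < p.+1) e r%:Z *: expz cm (p%:Z - r%:Z)
  (expz cp (z - r%:Z) v).
have EmL z' : linear (expz cm z') by apply: expz_linear.
apply/esym; apply: (@expz_uniq _ _ cp cpL cp0 F) => [{}z z0||q|q].
- by apply: big1 => r _; rewrite (@expz_neg _ _ cp) ?(lin0 (EmL _)) ?scaler0 //;
  lia.
- rewrite /F big_ord_recl /= e0 scale1r addn0 -[exp_coef cp _ v]/(expz cp 0 v)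
  expz0 // big1 ?addr0 // => r _.
  by rewrite (lin0 (EmL _)) scaler0.
- set z1 := q.+1%:Z.
  pose H (s : int) := expz cm (p%:Z - s) (expz cp (z1 - s) v).
  have step (n : 'I_q.+2) : n%:R *: cp n (F (z1 - n%:Z)) =
     \sum_(r < p.+1) (e r%:Z *: expz cm (p%:Z - r%:Z)
       (n%:R *: cp n (expz cp (z1 - r%:Z - n%:Z) v)))
     + n%:R * a n *: \sum_(r < p.+1) e (r%:Z - n%:Z) *: H r%:Z.
    rewrite -(@big_ord_shift _ p.+1 n (fun s t => e s *: H t)).
    + rewrite (lin_sum _ _ _ (cpL n)) !scaler_sumr -big_split /=.
      apply: eq_bigr => r _; rewrite (linZ _ _ (cpL n)) annihilate_exp
        !scalerDr.
      rewrite (linZ _ _ (EmL _)) !scalerA;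
        congr (_ *: expz _ _ (cp _ (expz _ _ _)) + _).
      * by rewrite mulrC.
      * by ring.
      * rewrite /H; congr (_ *: expz _ _ (expz _ _ _)); ring.
    + by move=> s t s0; rewrite e_neg ?scale0r.
    + by move=> s t ts; rewrite /H (@expz_neg _ _ cm) ?scaler0 //; lia.
  rewrite (eq_bigr _ (fun n _ => step n)) big_split /= exchange_big /=.
  have -> : \sum_(n < q.+2) n%:R * a n *:
    (\sum_(r < p.+1) e (r%:Z - n%:Z) *: H r%:Z) =
     \sum_(r < p.+1) (r%:R * e r%:Z) *: H r%:Z.
    under eq_bigr do rewrite scaler_sumr.
    rewrite exchange_big /=; apply: eq_bigr => r _.
    have [rq|qr] := ltnP r q.+2.
      under eq_bigr do rewrite scalerA.
      by rewrite -scaler_suml -e_rec ?ltz_nat // pmulrn.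
    have -> : H r = 0 by rewrite /H (@expz_neg _ _ cp) ?(lin0 (EmL _)) // /z1;
      lia.
    by rewrite scaler0 big1 // => n _; rewrite !scaler0.
  rewrite -big_split /= scaler_sumr; apply: eq_bigr => r _.
  rewrite -scaler_sumr -(lin_sum _ _ _ (EmL _)) -expz_rec //;
    last by rewrite /z1; lia.
  rewrite (linZ _ _ (EmL _)) /H !scalerA -scalerDl; congr (_ *: _).
  have -> : q.+1%:R = (z1 - r%:Z)%:~R + r%:R :> C.
    by rewrite [r%:R]pmulrn -intrD subrK.
  by ring.
- exact: expz_recS.
Qed.

End Heisenberg.

(* [scalar_exp a z] is the coefficient of [y^z] in [exp (\sum_n a n y^n)]. *)
Definition scalar_exp (C : numFieldType) (a : nat -> C) (z : int) : C :=
  expz (fun n (x : C^o) => a n *: x) z (1 : C^o).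

Lemma scalar_exp_neg (C : numFieldType) (a : nat -> C) (z : int) :
  z < 0 -> scalar_exp a z = 0.
Proof. by case: z. Qed.

Section ScalarExp.
Variables (C : numFieldType) (a : nat -> C).
Hypothesis a0 : a 0 = 0.

Let cL n : linear (fun x : C^o => a n *: x).
Proof. by move=> b x y; rewrite scalerDr !scalerA mulrC. Qed.

Lemma scalar_exp0 : scalar_exp a 0 = 1.
Proof. by rewrite /scalar_exp expz0 // => v; rewrite a0 scale0r. Qed.

Lemma scalar_exp_rec N (z : int) : z < N%:Z ->
  z%:~R * scalar_exp a z = \sum_(n < N) n%:R * a n * scalar_exp a (z - n%:Z).
Proof.
move=> zN; have := @expz_rec C C^o _ cL _ _ N z 1 zN.
rewrite -/(scalar_exp _ _) -[_ *: _]/(_ * _) => ->.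
- by apply: eq_bigr => n _; rewrite -mulrA.
- by move=> v; rewrite a0 scale0r.
- by move=> m n v; rewrite !scalerA mulrC.
Qed.

End ScalarExp.

(* exp (- \sum_(t >= 1) y^(s t) / t) = 1 - y^s, or 1 if [d] is false. *)
Lemma linear_exp_rec (C : numFieldType) (s : nat) (d : bool) (a : nat -> C)
    (e : int -> C) : (0 < s)%N ->
  (forall n, (0 < n)%N -> n%:R * a n = if d && (s %| n)%N then - s%:R else 0) ->
  (forall z, e z = (z == 0)%:R - (d && (z == s%:Z))%:R) ->
  forall N (z : int), z < N%:Z -> z%:~R * e z =
    \sum_(n < N) n%:R * a n * e (z - n%:Z).
Proof.
move=> s0 aE eE N z zN.
under eq_bigr do rewrite eE mulrBr.
rewrite sumrB.
have sumE (y : int) : y < N%:Z -> \sum_(n < N) n%:R * a n * (y - n%:Z == 0)%:R =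
    if 0 < y then (if d && (s %| `|y|)%N then - s%:R else 0) else 0.
  case: y => [[|q]|q] yN /=.
  - by apply: big1 => -[[|n] nN] _ /=; rewrite ?mul0r // mulr0.
  - rewrite (bigD1 (Ordinal (yN : (q.+1 < N)%N))) //= subrr eqxx mulr1 aE //.
    rewrite big1 ?addr0 // => n; rewrite -val_eqE /= => nq.
    rewrite subr_eq0 eqz_nat eq_sym; by rewrite (negbTE nq) mulr0.
  - by apply: big1 => n _; rewrite (_ : _ == 0 = false) ?mulr0 //; apply/eqP;
    lia.
rewrite sumE //.
have -> : \sum_(n < N) n%:R * a n * (d && (z - n%:Z == s%:Z))%:R =
   if d then (if 0 < z - s%:Z then
     (if d && (s %| `|z - s%:Z|)%N then - s%:R else 0) else 0) else 0.
  case: d aE eE sumE => aE eE sumE /=; last by rewrite big1 // => n _;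
    rewrite mulr0.
  rewrite -sumE; last by lia.
  by apply: eq_bigr => n _; congr (_ * (_)%:R); apply/eqP/eqP; lia.
rewrite eE; case: d {aE eE sumE} => /=; last by rewrite if_same !subr0;
  case: eqP => [->|_]; rewrite ?mul0r ?mulr0.
case: z zN => [[|q]|q] zN.
- rewrite mul0r /= sub0r; case: s s0 => // s _; by rewrite /= oppr0.
- rewrite /= sub0r; case: eqP => [[->]|qs].
    by rewrite subrr /= dvdnn mulrN1 subr0.
  rewrite oppr0 mulr0; case: ltP => sq.
    rewrite (_ : `|q.+1%:Z - s%:Z|%N = (q.+1 - s)%N); last by lia.
    by rewrite dvdn_subl ?dvdnn ?subrr //; clear -sq; lia.
  rewrite subr0; case: ifP => // /dvdn_leq; clear -sq qs; lia.
- by rewrite /= subrr mulr0 (_ : 0 < _ = false) ?subr0 //; apply/negbTE; lia.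
Qed.

(** * The Heisenberg module *)

Section HeisenbergModule.
Variables (C : numFieldType) (X : lattice_data) (eta : C).
Local Notation hh := (hh C X).
Local Notation k := (kk X).
Local Notation letter := (int * hh)%type.
Local Notation S_gen := (pgen (S_rel (X := X) eta)).
Local Notation S_mode := (@S_mode C X eta).

Definition bracket (m n : int) (g h : hh) : C :=
  if m + n == 0 then hform (proj eta m g) (proj eta n h) * (m%:~R / k%:R) else
    0.

Lemma S_gen_linear w w' n a (h h' : hh) :
  S_gen (w ++ (n, a *: h + h') :: w') =
  a *: S_gen (w ++ (n, h) :: w') + S_gen (w ++ (n, h') :: w').
Proof.
have := pgen_rel (S_linear eta w w' n a h h').
by rewrite mlin_genBZB => /subr0_eq /(canRL (subrK _)) ->; rewrite addrC.
Qed.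

Lemma S_gen_proj w w' n (h : hh) :
  S_gen (w ++ (n, h) :: w') = S_gen (w ++ (n, proj eta n h) :: w').
Proof.
have := pgen_rel (S_proj eta w w' n h).
by rewrite mlin_genB => /subr0_eq.
Qed.

Lemma S_gen_bracket w w' m n (g h : hh) :
  S_gen (w ++ (m, g) :: (n, h) :: w') =
  S_gen (w ++ (n, h) :: (m, g) :: w') + bracket m n g h *: S_gen (w ++ w').
Proof.
have := pgen_rel (S_bracket eta w w' m n g h).
by rewrite mlin_genBBZ; move=> /subr0_eq /(canRL (subrK _)) ->; rewrite addrC.
Qed.

Lemma S_gen_vacuum w n (h : hh) : 0 <= n -> S_gen (rcons w (n, h)) = 0.
Proof. by move=> n0; have := pgen_rel (S_vacuum eta w h n0);
  rewrite mlin_gen. Qed.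

Lemma S_mode_rel n (h : hh) x : S_rel eta x ->
  mlin (fun w => S_gen ((n, h) :: w)) x = 0.
Proof.
case=> {x} [w w' m a g g'|w w' m g|w w' m m' g g'|w m g m0].
- by rewrite mlin_genBZB -!cat_cons S_gen_linear addrAC addrK addrN.
- by rewrite mlin_genB -!cat_cons S_gen_proj subrr.
- by rewrite mlin_genBBZ -!cat_cons S_gen_bracket addrAC addrK addrN.
- by rewrite mlin_gen -rcons_cons S_gen_vacuum.
Qed.

Lemma S_mode_linear n (h : hh) : linear (S_mode n h).
Proof. exact/plift_linear/S_mode_rel. Qed.

Lemma S_mode_gen n (h : hh) w : S_mode n h (S_gen w) = S_gen ((n, h) :: w).
Proof. exact/plift_gen/S_mode_rel. Qed.

Lemma S_mode_linear_arg n v : linear (fun h : hh => S_mode n h v).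
Proof.
move=> a h h'; move: v; apply: presented_lin_eq.
- exact: S_mode_linear.
- move=> b x y; rewrite !(linP b x y (S_mode_linear _ _)).
  by rewrite !scalerDr !scalerA [b * a]mulrC; exact: addrACA.
- by move=> w; rewrite !S_mode_gen; exact: (S_gen_linear [::]).
Qed.

Lemma S_mode_proj n (h : hh) v : S_mode n h v = S_mode n (proj eta n h) v.
Proof.
move: v; apply: presented_lin_eq; try exact: S_mode_linear.
by move=> w; rewrite !S_mode_gen; exact: (S_gen_proj [::]).
Qed.

Lemma S_mode_bracket m n (g h : hh) v : S_mode m g (S_mode n h v) =
  S_mode n h (S_mode m g v) + bracket m n g h *: v.
Proof.
move: v; apply: presented_lin_eq.
- exact: lin_comp (S_mode_linear _ _) (S_mode_linear _ _).
- move=> a x y; rewrite (linP a x y (S_mode_linear _ _))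
  (linP a _ _ (S_mode_linear _ _)).
  rewrite !scalerDr !scalerA [bracket _ _ _ _ * _]mulrC.
  by rewrite addrACA.
- by move=> w; rewrite !S_mode_gen; exact: (S_gen_bracket [::]).
Qed.

Lemma S_mode_vac n (h : hh) : 0 <= n -> S_mode n h (S_gen [::]) = 0.
Proof. by move=> n0; rewrite S_mode_gen; exact: (S_gen_vacuum [::]). Qed.

(* A vector [v] of [Snu] is represented by the function sending a sequence
   [y_1, .., y_m] of annihilators to the vacuum expectation of
   [y_1 .. y_m v]. An annihilator then acts by [F \o cons y] and a creator [x]
   by Wick's formula, contracting [x] with each [y_i] in turn. *)
Definition contract (y x : letter) : C :=
  if 0 < y.1 then bracket y.1 x.1 y.2 x.2 else 0.

Fixpoint contract_sum (c : letter -> C) (F : seq letter -> C) (ys : seq letter)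
  : C :=
  if ys is y :: ys' then
    c y * F ys' + contract_sum c (fun zs => F (y :: zs)) ys'
  else 0.

Definition wick_step (x : letter) (F : seq letter -> C) (ys : seq letter) : C :=
  if 0 < x.1 then F (x :: ys) else contract_sum (contract^~ x) F ys.

Definition wick (w : seq letter) : seq letter -> C :=
  foldr wick_step (fun ys => (ys == [::])%:R) w.

Lemma contract_sum_lin c a F G ys :
  contract_sum c (fun zs => a * F zs + G zs) ys =
  a * contract_sum c F ys + contract_sum c G ys.
Proof.
elim: ys F G => [|y ys IH] F G /=; first by rewrite mulr0 addr0.
by rewrite IH; ring.
Qed.

Lemma contract_sum_linl a c d e F ys : (forall y, e y = a * c y + d y) ->
  contract_sum e F ys = a * contract_sum c F ys + contract_sum d F ys.
Proof.
move=> eE; elim: ys F => [|y ys IH] F /=; first by rewrite mulr0 addr0.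
by rewrite IH eE; ring.
Qed.

Lemma contract_sum_ext c d F G ys : c =1 d -> F =1 G ->
  contract_sum c F ys = contract_sum d G ys.
Proof.
by move=> cd; elim: ys F G => //= y ys IH F G FG;
  rewrite cd FG (IH _ (fun zs => G (y :: zs))).
Qed.

Lemma contract_sum0 c F ys : (forall y, c y = 0) -> contract_sum c F ys = 0.
Proof. by move=> c0; elim: ys F => //= y ys IH F;
  rewrite c0 mul0r IH addr0. Qed.

Lemma contract_sumC c d F ys :
  contract_sum c (contract_sum d F) ys = contract_sum d (contract_sum c F) ys.
Proof.
by elim: ys F => //= y ys IH F; rewrite !contract_sum_lin IH; ring.
Qed.

(** Annihilators commute with each other; this is why [wick_step] may put a new one in front of the
    others. *)
Definition exchangeable (F : seq letter -> C) := forall u y z ys,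
  F (u ++ y :: z :: ys) = F (u ++ z :: y :: ys).

Lemma exchangeable_contract c F : exchangeable F ->
  exchangeable (contract_sum c F).
Proof.
move=> Fex u y z ys; elim: u F Fex => [|x u IH] F Fex /=.
  rewrite (@contract_sum_ext c c (fun zs => F [:: y, z & zs])
    (fun zs => F [:: z, y & zs])) //.
    by ring.
  by move=> zs; exact: (Fex [::]).
by rewrite Fex IH // => v; exact: (Fex (x :: v)).
Qed.

Lemma exchangeable_wick w : exchangeable (wick w).
Proof.
elim: w => [|x w IH]; first by case.
move=> u y z ys; rewrite /wick /= /wick_step; case: ifP => _.
  exact: (IH (x :: u)).
exact: exchangeable_contract.
Qed.

Definition multilinear (F : seq letter -> C) := forall u n a (h h' : hh) ys,
  F (u ++ (n, a *: h + h') :: ys) =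
    a * F (u ++ (n, h) :: ys) + F (u ++ (n, h') :: ys).

Lemma nup_linear j : linear (nup (X := X) j : hh -> hh).
Proof. by move=> a g h; apply/rowP => i; rewrite !mxE. Qed.

Lemma proj_linear n : linear (proj (X := X) eta n).
Proof.
move=> a g h; rewrite /proj scalerA mulrC -scalerA -scalerDr; congr (_ *: _).
rewrite scaler_sumr -big_split; apply: eq_bigr => j _ /=.
by rewrite (linP _ _ _ (nup_linear j)) scalerDr !scalerA [a * _]mulrC.
Qed.

Lemma hform_linearl (h : hh) : linear (hform (X := X) ^~ h : hh -> C^o).
Proof. by move=> a g g'; rewrite /hform !mulmxDl -!scalemxAl !mxE. Qed.

Lemma hform_linear (g : hh) : linear (hform (X := X) g : hh -> C^o).
Proof. by move=> a h h';
  rewrite /hform linearD linearZ mulmxDr -!scalemxAr !mxE. Qed.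

Lemma bracket_linearl m n a (g g' h : hh) :
  bracket m n (a *: g + g') h = a * bracket m n g h + bracket m n g' h.
Proof.
rewrite /bracket; case: ifP => _; last by rewrite mulr0 addr0.
by rewrite proj_linear (hform_linearl _) -[a *: _]/(a * _); ring.
Qed.

Lemma bracket_linear m n a (g h h' : hh) :
  bracket m n g (a *: h + h') = a * bracket m n g h + bracket m n g h'.
Proof.
rewrite /bracket; case: ifP => _; last by rewrite mulr0 addr0.
by rewrite proj_linear (hform_linear _) -[a *: _]/(a * _); ring.
Qed.

Lemma multilinear_contract x F : multilinear F ->
  multilinear (contract_sum (contract^~ x) F).
Proof.
move=> Fm u n a h h' ys; elim: u F Fm => [|y u IH] F Fm /=.
  rewrite (@contract_sum_ext _ (contract^~ x)
    (fun zs => F ((n, a *: h + h') :: zs))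
     (fun zs => a * F ((n, h) :: zs) + F ((n, h') :: zs))) //; last first.
    by move=> zs; exact: (Fm [::]).
  rewrite contract_sum_lin /contract /=; case: ifP => _; last by ring.
  by rewrite bracket_linearl; ring.
by rewrite Fm IH; [ring|move=> v; exact: (Fm (y :: v))].
Qed.

Lemma multilinear_wick w : multilinear (wick w).
Proof.
elim: w => [|x w IH] u n a h h' ys.
  by rewrite /wick /=; case: u => [|y u] /=; rewrite mulr0 addr0.
rewrite /wick /= /wick_step; case: ifP => _; first exact: (IH (x :: u)).
exact: multilinear_contract.
Qed.

Lemma wick_step_lin x a F G ys :
  wick_step x (fun zs => a * F zs + G zs) ys =
    a * wick_step x F ys + wick_step x G ys.
Proof. by rewrite /wick_step; case: ifP => // _; exact: contract_sum_lin. Qed.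

Lemma wick_step_ext x F G : F =1 G -> wick_step x F =1 wick_step x G.
Proof. by move=> FG ys; rewrite /wick_step; case: ifP => // _;
  exact: contract_sum_ext. Qed.

(** A prefix of a word acts linearly, so a relation need only be checked at the place in the word
    where it occurs. *)
Lemma foldr_wick_lin w a F G H : (forall ys, H ys = a * F ys + G ys) ->
  forall ys,
  foldr wick_step H w ys = a * foldr wick_step F w ys + foldr wick_step G w ys.
Proof.
move=> HE; elim: w => //= x w IH ys.
by rewrite -wick_step_lin; apply: wick_step_ext.
Qed.

Lemma foldr_wick0 w F : (forall ys, F ys = 0) ->
  forall ys, foldr wick_step F w ys = 0.
Proof.
move=> F0 ys; have := @foldr_wick_lin w (-1) F F F _ ys.
by rewrite mulN1r addNr; apply=> zs; rewrite F0 mulr0 addr0.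
Qed.

Lemma nup0 (T : Type) (a : 'rV[T]_(rk X)) : nup 0 a = a.
Proof. by apply/rowP => j; rewrite mxE invg1 perm1. Qed.

Lemma nupD (T : Type) i j (a : 'rV[T]_(rk X)) : nup i (nup j a) = nup (i + j) a.
Proof. by apply/rowP => l; rewrite !mxE addnC expgD invMg permM. Qed.

Lemma nup_kk (T : Type) (a : 'rV[T]_(rk X)) : nup k a = a.
Proof.
by apply/rowP => j; rewrite mxE /kk mulnC expgM expg_order expg1n invg1 perm1.
Qed.

Lemma nup_ordnu (T : Type) (a : 'rV[T]_(rk X)) : nup (ordnu X) a = a.
Proof. by apply/rowP => j; rewrite mxE expg_order invg1 perm1. Qed.

Lemma kk_gt0 : (0 < k)%N.
Proof. by rewrite muln_gt0 order_gt0. Qed.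

Lemma hform_nup (g h : hh) : hform (nup 1 g) (nup 1 h) = hform g h.
Proof.
rewrite /hform !mxE (reindex_inj (@perm_inj _ (nu X))) /=;
  apply: eq_bigr => j _.
rewrite !mxE expg1 permK; congr (_ * _).
rewrite (reindex_inj (@perm_inj _ (nu X))) /=; apply: eq_bigr => i _.
by rewrite !mxE permK nu_isometry.
Qed.

Lemma hform_nupX j (g h : hh) : hform (nup j g) (nup j h) = hform g h.
Proof.
elim: j => [|j IH]; first by rewrite !nup0.
by rewrite -add1n -(nupD 1 j g) -(nupD 1 j h) hform_nup.
Qed.

Hypothesis eta_prim : k.-primitive_root eta.

Lemma eta_neq0 : eta != 0.
Proof.
apply/eqP => eta0; have := prim_expr_order eta_prim; rewrite eta0 expr0n.
by rewrite gtn_eqF ?kk_gt0 // => /esym/eqP; rewrite oner_eq0.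
Qed.

Let eta0 := eta_neq0.

Lemma kk_neq0 : k%:R != 0 :> C.
Proof. by rewrite pnatr_eq0 -lt0n kk_gt0. Qed.

Let kR0 := kk_neq0.

Lemma eta_expzM (n : int) : eta ^ (n * k%:Z) = 1.
Proof. by rewrite mulrC -exprz_exp -exprnP (prim_expr_order eta_prim) exp1rz.
  Qed.

(** The summand has period k in j, so shifting j only brings out the factor eta^n. *)
Lemma proj_shift n (h : hh) :
  \sum_(j < k) eta ^ (- (n * j%:Z)) *: (nup j.+1 h : hh)
    = eta ^ n *: \sum_(j < k) eta ^ (- (n * j%:Z)) *: (nup j h : hh).
Proof.
pose f j := eta ^ (- (n * j%:Z)) *: (nup j h : hh).
have -> : \sum_(j < k) f j = \sum_(j < k) f j.+1.
  apply: (addIr (f k)); rewrite -(big_ord_recr k (fun j : 'I_k.+1 => f j)) /=.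
  rewrite big_ord_recl addrC /=; congr (_ + _); rewrite /f nup_kk nup0.
  by rewrite mulr0 oppr0 -mulNr eta_expzM.
rewrite scaler_sumr; apply: eq_bigr => j _.
rewrite /f scalerA -expfzDr //; congr (eta ^ _ *: _).
by rewrite -addn1 PoszD; ring.
Qed.

Lemma nup_proj n (h : hh) : nup 1 (proj eta n h) = eta ^ n *: proj eta n h.
Proof.
rewrite /proj (linZ _ _ (nup_linear 1)) (lin_sum _ _ _ (nup_linear 1)).
rewrite scalerA mulrC -scalerA -proj_shift; congr (_ *: _).
by apply: eq_bigr => j _; rewrite (linZ _ _ (nup_linear 1)) nupD.
Qed.

Lemma proj_nup n (h : hh) : proj eta n (nup 1 h) = eta ^ n *: proj eta n h.
Proof.
rewrite /proj scalerA mulrC -scalerA -proj_shift; congr (_ *: _).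
by apply: eq_bigr => j _; rewrite nupD addn1.
Qed.

Lemma nup_eigen n (g : hh) j : nup 1 g = eta ^ n *: g -> nup j g =
  eta ^ (n * j%:Z) *: g.
Proof.
move=> gE; elim: j => [|j IH]; first by rewrite nup0 mulr0 scale1r.
rewrite -[j.+1]/(1 + j)%N -(nupD 1) IH (linZ _ _ (nup_linear 1)) gE scalerA
  -expfzDr //.
by congr (eta ^ _ *: _); rewrite PoszD; ring.
Qed.

Lemma proj_eigen n (g : hh) : nup 1 g = eta ^ n *: g -> proj eta n g = g.
Proof.
move=> gE; rewrite /proj; under eq_bigr => j _.
  by rewrite (nup_eigen j gE) scalerA -expfzDr // addNr scale1r over.
by rewrite sumr_const card_ord -scaler_nat scalerA mulVf // scale1r.
Qed.

Lemma proj_id n (h : hh) : proj eta n (proj eta n h) = proj eta n h.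
Proof. exact/proj_eigen/nup_proj. Qed.

(** As the form is nu-invariant, all k terms in the projection of g pair equally with an eigenvector
    of eigenvalue eta^(-n). *)
Lemma hform_projN n (g h : hh) :
  hform (proj eta n g) (proj eta (- n) h) = hform g (proj eta (- n) h).
Proof.
have := nup_proj (- n) h; move: (proj eta (- n) h) => p pE.
rewrite /proj (linZ _ _ (hform_linearl _)) (lin_sum _ _ _ (hform_linearl _)).
have step (j : 'I_k) : hform (eta ^ (- (n * j%:Z)) *: (nup j g : hh)) p =
  hform g p.
  rewrite (linZ _ _ (hform_linearl _)) -[in RHS](hform_nupX j g p).
  by rewrite (nup_eigen j pE) (linZ _ _ (hform_linear _)) mulNr.
rewrite (eq_bigr _ (fun j _ => step j)) sumr_const card_ord.
by rewrite -(scaler_nat k (hform g p : C^o)) scalerA mulVf // scale1r.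
Qed.

Lemma bracket_projl m n (g h : hh) : bracket m n (proj eta m g) h =
  bracket m n g h.
Proof. by rewrite /bracket proj_id. Qed.

Lemma bracket_projr m n (g h : hh) : bracket m n g (proj eta n h) =
  bracket m n g h.
Proof. by rewrite /bracket proj_id. Qed.

Lemma hformC (g h : hh) : hform g h = hform h g.
Proof.
rewrite /hform -[in LHS](trmxK (_ *m _ *m _)) mxE !trmx_mul trmxK mulmxA.
by rewrite map_trmx gram_sym.
Qed.

Lemma bracketC m n (g h : hh) : bracket m n g h = - bracket n m h g.
Proof.
rewrite /bracket [n + m]addrC; case: eqP => [mn|_]; last by rewrite oppr0.
have -> : m = - n by apply/eqP; rewrite -addr_eq0 mn.
by rewrite hformC rmorphN /= mulNr mulrN.
Qed.

Lemma wick_proj_inv w u n (h : hh) ys :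
  wick w (u ++ (n, h) :: ys) = wick w (u ++ (n, proj eta n h) :: ys).
Proof.
elim: w u ys => [|x w IH] u ys; first by case: u.
rewrite /wick /= /wick_step; case: ifP => _; first exact: (IH (x :: u)).
have : forall u ys, foldr wick_step (fun ys => (ys == [::])%:R) w
  (u ++ (n, h) :: ys)
   = foldr wick_step (fun ys => (ys == [::])%:R) w
     (u ++ (n, proj eta n h) :: ys) by [].
move: (foldr _ _ _) => F {}IH; elim: u F IH => [|y u IHu] F IH /=.
  rewrite /contract /= bracket_projl; congr (_ + _).
  by apply: contract_sum_ext => // zs; exact: (IH [::]).
by rewrite IH (IHu (fun zs => F (y :: zs))) // => v zs; exact: (IH (y :: v)).
Qed.

Lemma wick_cat w w' : wick (w ++ w') = foldr wick_step (wick w') w.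
Proof. by rewrite /wick foldr_cat. Qed.

(** This makes the vacuum expectation well defined. In the bracket relation, the contraction of an
    annihilator with the adjacent creator is exactly the bracket; two annihilators commute by
    [exchangeable_wick], two creators by [contract_sumC]. *)
Lemma wick_rel ys x : S_rel eta x -> mlin (fun w => wick w ys : C^o) x = 0.
Proof.
case=> {x} [w w' n a h h'|w w' n h|w w' m n g h|w n h n0].
- rewrite mlin_genBZB !wick_cat
  (@foldr_wick_lin w a (wick ((n, h) :: w')) (wick ((n, h') :: w'))).
    by rewrite /GRing.scale /=; ring.
  move=> zs; rewrite /wick /= /wick_step /=; case: ifP => _.
    exact: (multilinear_wick w' [::]).
  apply: contract_sum_linl => y; rewrite /contract; case: ifP => _;
    last by ring.
  exact: bracket_linear.
- rewrite mlin_genB !wick_cat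
  (@foldr_wick_lin w 1 (wick ((n, proj eta n h) :: w')) (fun=> 0)).
    by rewrite (foldr_wick0 w (F := fun=> 0)) // mul1r addr0 subrr.
  move=> zs; rewrite mul1r addr0 /wick /= /wick_step /=; case: ifP => _.
    exact: (wick_proj_inv w' [::]).
  by apply: contract_sum_ext => // y; rewrite /contract bracket_projr.
- rewrite mlin_genBBZ !wick_cat
  (@foldr_wick_lin w (bracket m n g h) (wick w')
  (wick [:: (n, h), (m, g) & w'])).
    by rewrite /GRing.scale /=; rewrite -/(bracket m n g h); ring.
  move=> zs; rewrite /wick /=; set F := foldr _ _ w'.
  have Fex : exchangeable F by exact: exchangeable_wick.
  rewrite /wick_step /=; case: ifPn => m0; case: ifPn => n0 /=.
  + rewrite (Fex [::]) /bracket ifF ?mul0r ?add0r //; apply/eqP; lia.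
  + by rewrite /contract /= m0.
  + rewrite /contract /= n0 [bracket n m _ _]bracketC; ring.
  (* Neither index is positive, so m + n = 0 leaves only m = n = 0, where the factor m of the
     bracket vanishes. *)
  + rewrite contract_sumC /bracket; case: eqP => [mn|_];
    last by rewrite mul0r add0r.
    have -> : m = 0 by lia.
    by rewrite mul0r mulr0 mul0r add0r.
- rewrite mlin_gen -cats1 wick_cat foldr_wick0 // => zs.
  rewrite /wick /= /wick_step /=; case: ifP => // n1.
  (* Only the zero mode n = 0 is left. It is contracted with letters of positive index only, and
     then the two indices do not sum to 0. *)
  apply: contract_sum0 => y; rewrite /contract; case: ifP => // y0.
  by rewrite /bracket ifF //; apply/eqP => yn; have := ltr_wpDr n0 y0;
    rewrite yn ltxx.
Qed.

Definition vev : Snu X eta -> C^o := plift (fun w => wick w [::] : C^o).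

Lemma vev_linear : linear vev.
Proof. exact/plift_linear/wick_rel. Qed.

Lemma vev_vac : vev (S_gen [::]) = 1.
Proof. by rewrite /vev plift_gen //; exact: wick_rel. Qed.

Lemma S_vac_neq0 : S_gen [::] != 0.
Proof.
apply/eqP => vac0; have := vev_vac.
by rewrite vac0 (lin0 vev_linear) => /esym/eqP; rewrite oner_eq0.
Qed.

Lemma S_mode_nup n (h : hh) v : S_mode n (nup 1 h) v = eta ^ n *: S_mode n h v.
Proof.
rewrite S_mode_proj proj_nup (linZ _ _ (S_mode_linear_arg n v)).
by rewrite -S_mode_proj.
Qed.

Lemma S_mode_nupX n j (h : hh) v : S_mode n (nup j h) v =
  eta ^ (n * j%:Z) *: S_mode n h v.
Proof.
elim: j => [|j IH]; first by rewrite nup0 mulr0 scale1r.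
rewrite -[j.+1]/(1 + j)%N -(nupD 1) S_mode_nup IH scalerA -expfzDr //.
by congr (eta ^ _ *: _); rewrite PoszD; ring.
Qed.

End HeisenbergModule.

(** * Tensor products and the induced module *)

Section TensorTheory.
Variables (C : fieldType) (S U : lmodType C).
Local Notation T := (tensor S U).

Lemma tens_linearl (u : U) : linear (fun s : S => tens s u : T).
Proof.
move=> a s s'; have := pgen_rel (TensorRelL a s s' u).
rewrite mlin_genBZB.
by move/subr0_eq/(canRL (subrK _)); rewrite /tens => ->; rewrite addrC.
Qed.

Lemma tens_linear (s : S) : linear (fun u : U => tens s u : T).
Proof.
move=> a u u'; have := pgen_rel (TensorRelR a s u u').
rewrite mlin_genBZB.
by move/subr0_eq/(canRL (subrK _)); rewrite /tens => ->; rewrite addrC.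
Qed.

Lemma tensor_rel_bilinear (W : lmodType C) (b : S -> U -> W) :
  (forall u, linear (b^~ u)) -> (forall s, linear (b s)) ->
  forall x, tensor_rel x -> mlin (fun su => b su.1 su.2) x = 0.
Proof.
move=> bl br x [] => [a s s' u|a s u u'];
  rewrite mlin_genBZB /=.
  by rewrite (linP a s s' (bl u)) addrAC addrK addrN.
by rewrite (linP a u u' (br s)) addrAC addrK addrN.
Qed.

Section TensorMap.
Variables (f : S -> S) (g : U -> U).
Hypotheses (fL : linear f) (gL : linear g).

Let tensor_map_rel := @tensor_rel_bilinear _ (fun s u => tens (f s) (g u) : T)
  (fun u => lin_comp (tens_linearl (g u)) fL)
  (fun s => lin_comp (tens_linear (f s)) gL).

Lemma tensor_map_linear : linear (tensor_map f g).
Proof. exact: plift_linear tensor_map_rel. Qed.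

Lemma tensor_map_tens s u : tensor_map f g (tens s u) = tens (f s) (g u).
Proof. exact: (plift_gen tensor_map_rel). Qed.

End TensorMap.

(** Reduces a linear relation in the tensor product to one in S, with phi selecting the part to be
    kept. *)
Definition tensor_contract (phi : U -> C^o) : T -> S := 
  plift (fun su => (phi su.2 : C) *: su.1).

Section TensorContract.
Variable phi : U -> C^o.
Hypothesis phiL : linear phi.

Let tensor_contract_rel : forall x, tensor_rel x ->
  mlin (fun su : S * U => (phi su.2 : C) *: su.1) x = 0.
Proof.
apply: (@tensor_rel_bilinear _ (fun s u => (phi u : C) *: s)) => [u|s] a x y.
  by rewrite scalerDr !scalerA mulrC.
by rewrite (linP a x y phiL) scalerDl scalerA.
Qed.

Lemma tensor_contract_linear : linear (tensor_contract phi).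
Proof. exact: plift_linear tensor_contract_rel. Qed.

Lemma tensor_contract_tens s u : tensor_contract phi (tens s u) =
  (phi u : C) *: s.
Proof. exact: (plift_gen tensor_contract_rel). Qed.

End TensorContract.
End TensorTheory.

(** * The group law of the twisted extension *)

Section LatticeExtension.
Variable X : lattice_data.
Implicit Types (a b c : lat X) (x y z : lhat X).

Lemma lformDl a b c : lform (a + b) c = lform a c + lform b c.
Proof. by rewrite /lform !mulmxDl mxE. Qed.

Lemma lformDr a b c : lform a (b + c) = lform a b + lform a c.
Proof. by rewrite /lform linearD mulmxDr mxE. Qed.

(** The 2-cocycle of [lhatnu_mul] in additive notation; its bimultiplicativity yields the group
    axioms. *)
Definition cocycle a b : 'Z_(kk X) := eps a b - nu_twist a b.

Lemma cocycleDl a b c : cocycle (a + b) c = cocycle a c + cocycle b c.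
Proof.
rewrite /cocycle addrACA -opprD; congr (_ - _); last first.
  rewrite /nu_twist -big_split; apply: eq_bigr => j _ /=.
  rewrite -mulrDr -intrD -lformDl; congr (_ * (lform _ _)%:~R).
  by apply/rowP => i; rewrite !mxE.
rewrite /eps -mulrDr -intrD -big_split /=; congr (_ * _%:~R).
apply: eq_bigr => i _; rewrite -big_split /=; apply: eq_bigr => j _.
by rewrite mxE; ring.
Qed.

Lemma cocycleDr a b c : cocycle a (b + c) = cocycle a b + cocycle a c.
Proof.
rewrite /cocycle addrACA -opprD; congr (_ - _); last first.
  rewrite /nu_twist -big_split; apply: eq_bigr => j _ /=.
  by rewrite -mulrDr -intrD -lformDr.
rewrite /eps -mulrDr -intrD -big_split /=; congr (_ * _%:~R).
apply: eq_bigr => i _; rewrite -big_split /=; apply: eq_bigr => j _.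
by rewrite mxE; ring.
Qed.

Lemma cocycle0l b : cocycle 0 b = 0.
Proof. by apply: (addrI (cocycle 0 b)); rewrite -cocycleDl !addr0. Qed.

Lemma cocycle0r a : cocycle a 0 = 0.
Proof. by apply: (addrI (cocycle a 0)); rewrite -cocycleDr !addr0. Qed.

Lemma cocycleNl a b : cocycle (- a) b = - cocycle a b.
Proof. by apply/eqP; rewrite -addr_eq0 -cocycleDl addNr cocycle0l. Qed.

Lemma cocycleNr a b : cocycle a (- b) = - cocycle a b.
Proof. by apply/eqP; rewrite -addr_eq0 -cocycleDr addNr cocycle0r. Qed.

Lemma lhatnu_mulE x y : lhatnu_mul x y =
  (x.1 + y.1 + cocycle x.2 y.2, x.2 + y.2).
Proof. by rewrite /lhatnu_mul /= addrA. Qed.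

Lemma lhatnu_mulA x y z :
  lhatnu_mul x (lhatnu_mul y z) = lhatnu_mul (lhatnu_mul x y) z.
Proof.
rewrite !lhatnu_mulE /=; congr (_, _); last by rewrite addrA.
by rewrite cocycleDl cocycleDr; ring.
Qed.

Lemma lhatnu_mul1 x : lhatnu_mul x (lhatnu_one X) = x.
Proof. by case: x => s a; rewrite lhatnu_mulE /= cocycle0r !addr0. Qed.

Lemma lhatnu_1mul x : lhatnu_mul (lhatnu_one X) x = x.
Proof. by case: x => s a; rewrite lhatnu_mulE /= cocycle0l addr0 !add0r. Qed.

Lemma lhatnu_mulV x : lhatnu_mul x (lhatnu_inv x) = lhatnu_one X.
Proof.
rewrite lhatnu_mulE /= -/(cocycle x.2 (- x.2)) subrr.
by congr (_, _); ring.
Qed.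

Lemma lhatnu_mulVl x : lhatnu_mul (lhatnu_inv x) x = lhatnu_one X.
Proof.
rewrite lhatnu_mulE /= -/(cocycle x.2 (- x.2)) addNr cocycleNr cocycleNl.
by congr (_, _); ring.
Qed.

End LatticeExtension.

(** * The induced module U_T *)

Section InducedModule.
Variables (C : numFieldType) (X : lattice_data) (eta : C) (tau : lhat X -> C).
Hypothesis tau_neq0 : forall x : lhat X, latN eta x.2 -> tau x != 0.
Hypothesis tauM : forall x y : lhat X, latN eta x.2 -> latN eta y.2 ->
  tau (lhatnu_mul x y) = tau x * tau y.
Implicit Types (a b : lat X) (x y : lhat X).

Lemma tohD a b : toh C (a + b) = toh C a + toh C b.
Proof. by apply/rowP => i; rewrite !mxE intrD. Qed.

Lemma tohN a : toh C (- a) = - toh C a.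
Proof. by apply/rowP => i; rewrite !mxE rmorphN. Qed.

Lemma latN0 : latN eta (0 : lat X).
Proof.
move=> h _; rewrite (_ : toh C 0 = 0) ?(lin0 (hform_linearl h)) //.
by apply/rowP => i; rewrite !mxE.
Qed.

Lemma latND a b : latN eta a -> latN eta b -> latN eta (a + b).
Proof. by move=> aN bN h hE;
  rewrite tohD (linD _ _ (hform_linearl h)) aN // bN // addr0. Qed.

Lemma latNN a : latN eta a -> latN eta (- a).
Proof. by move=> aN h hE;
  rewrite tohN -scaleN1r (linZ _ _ (hform_linearl h)) aN // scaler0. Qed.

Local Notation U_gen := (pgen (U_rel eta tau)).

Lemma U_gen_mul x y : latN eta y.2 -> U_gen (lhatnu_mul x y) = tau y *: U_gen x.
Proof.
move=> yN; have := pgen_rel (U_ind tau x yN).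
rewrite mlin_genBZ.
by move/subr0_eq.
Qed.

Lemma U_rel_plift (W : lmodType C) (f : lhat X -> W) :
  (forall x y, latN eta y.2 -> f (lhatnu_mul x y) = tau y *: f x) ->
  forall z, U_rel eta tau z -> mlin f z = 0.
Proof.
move=> fM _ [x y yN]; by rewrite mlin_genBZ fM // subrr.
Qed.

Let U_act_rel x : forall z, U_rel eta tau z ->
  mlin (fun y => U_gen (lhatnu_mul x y)) z = 0.
Proof. by apply: U_rel_plift => y z zN; rewrite lhatnu_mulA U_gen_mul. Qed.

Local Notation U_act := (@U_act C X eta tau).

Lemma U_act_linear x : linear (U_act x).
Proof. exact/plift_linear/U_act_rel. Qed.

Lemma U_act_gen x y : U_act x (U_gen y) = U_gen (lhatnu_mul x y).
Proof. exact/plift_gen/U_act_rel. Qed.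

(** The element y^(-1) x lies over N, so it moves across the tensor sign and acts by its nonzero
    value under tau. *)
Lemma U_gen_coset x y : latN eta (x.2 - y.2) ->
  exists2 a, a != 0 & U_gen x = a *: U_gen y.
Proof.
move=> xyN; exists (tau (lhatnu_mul (lhatnu_inv y) x)).
  by apply: tau_neq0; rewrite lhatnu_mulE /= addrC.
rewrite -U_gen_mul; last by rewrite lhatnu_mulE /= addrC.
by rewrite lhatnu_mulA lhatnu_mulV lhatnu_1mul.
Qed.

Lemma tau1 : tau (lhatnu_one X) = 1.
Proof.
apply: (mulfI (tau_neq0 (x := lhatnu_one X) latN0)).
by rewrite -tauM ?lhatnu_mul1 ?mulr1 //; exact: latN0.
Qed.

(** If x = y n with n over N, the generator of x is tau(n) times that of y; all other cosets get 0.
    The resulting functional shows that generators are nonzero and that different cosets are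
    independent. *)
Definition U_coord_fun y x : C :=
  if `[< latN eta (x.2 - y.2) >] then tau (lhatnu_mul (lhatnu_inv y) x) else 0.

Definition U_coord y : UT eta tau -> C^o :=
  plift (U_coord_fun y : lhat X -> C^o).

Let U_coord_rel y : forall z, U_rel eta tau z ->
  mlin (U_coord_fun y : lhat X -> C^o) z = 0.
Proof.
apply: U_rel_plift => x z zN; rewrite /U_coord_fun.
have -> : `[< latN eta ((lhatnu_mul x z).2 - y.2) >] =
  `[< latN eta (x.2 - y.2) >].
  apply: asbool_equiv_eq; rewrite lhatnu_mulE /=; split=> xN.
    by have := latND xN (latNN zN); rewrite addrAC addrK.
  by have := latND xN zN; rewrite addrAC.
case: asboolP => [xN|_]; last by rewrite scaler0.
rewrite lhatnu_mulA tauM //; first by rewrite mulrC.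
by rewrite lhatnu_mulE /= addrC.
Qed.

Lemma U_coord_linear y : linear (U_coord y).
Proof. exact/plift_linear/U_coord_rel. Qed.

Lemma U_coord_gen y x : U_coord y (U_gen x) = U_coord_fun y x.
Proof. exact/plift_gen/U_coord_rel. Qed.

Lemma U_coord_id y : U_coord y (U_gen y) = 1.
Proof.
rewrite U_coord_gen /U_coord_fun lhatnu_mulVl tau1 ifT //.
by apply/asboolP; rewrite subrr; exact: latN0.
Qed.

Lemma U_coord_neq y x : ~ latN eta (x.2 - y.2) -> U_coord y (U_gen x) = 0.
Proof. by move=> xyN; rewrite U_coord_gen /U_coord_fun; case: asboolP. Qed.

Section XPow.
Variables (h : hh C X) (c : C).
Hypothesis h0 : eigen eta 0 h.

Let U_xpow_rel : forall z, U_rel eta tau z ->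
  mlin (fun y : lhat X => if hform h (toh C y.2) == c then U_gen y else 0) z =
    0.
Proof.
apply: U_rel_plift => x y yN; rewrite [(lhatnu_mul x y).2]/(x.2 + y.2) tohD.
rewrite (linD _ _ (hform_linear h)) [hform h (toh C y.2)]hformC (yN _ h0) addr0.
case: (hform h (toh C x.2) == c).
  exact: (U_gen_mul x yN).
by rewrite scaler0.
Qed.

Lemma U_xpow_linear : linear (@U_xpow C X eta tau h c).
Proof. exact/plift_linear/U_xpow_rel. Qed.

Lemma U_xpow_gen y : @U_xpow C X eta tau h c (U_gen y) =
  if hform h (toh C y.2) == c then U_gen y else 0.
Proof. exact: (plift_gen U_xpow_rel). Qed.

End XPow.

Section Sign.
Variable r : 'I_(ncyc X).
Hypothesis charge_N : forall a, latN eta a -> charge r a = 0.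

Lemma chargeD a b : charge r (a + b) = charge r a + charge r b.
Proof. by rewrite /charge -big_split; apply: eq_bigr => j _; rewrite mxE. Qed.

Let U_sign_rel : forall z, U_rel eta tau z ->
  mlin (fun y : lhat X => (-1) ^ charge r y.2 *: U_gen y) z = 0.
Proof.
apply: U_rel_plift => x y yN; rewrite [(lhatnu_mul x y).2]/(x.2 + y.2).
by rewrite chargeD (charge_N yN) addr0 (U_gen_mul x yN) !scalerA mulrC.
Qed.

Lemma U_sign_linear : linear (@U_sign C X eta tau r).
Proof. exact/plift_linear/U_sign_rel. Qed.

Lemma U_sign_gen y : @U_sign C X eta tau r (U_gen y) =
  (-1) ^ charge r y.2 *: U_gen y.
Proof. exact: (plift_gen U_sign_rel). Qed.

End Sign.
End InducedModule.

(** * Orbits of the basis and the modes of E^+ and E^- *)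

Lemma sum_dvdn (l k : nat) : (0 < k)%N -> (l %| k)%N ->
  (\sum_(t < k) (l %| t) = k %/ l)%N.
Proof.
move=> k0 lk; apply: (@addIn 1).
have -> : (\sum_(t < k) (l %| t) + 1 = \sum_(t < k.+1) (l %| t))%N.
  by rewrite big_ord_recr /= lk.
by rewrite big_ord_recl dvdn0 /= addnC divn_count_dvd big_add1 /= big_mkord.
Qed.

Section Orbits.
Variables (C : numFieldType) (X : lattice_data) (eta : C).
Hypothesis eta_prim : (kk X).-primitive_root eta.
Local Notation hh := (hh C X).
Local Notation k := (kk X).
Local Notation toh := (@toh C X).
Implicit Types (r s : 'I_(ncyc X)) (a b : lat X) (i : 'I_(rk X)).

(** The spacing 1 / l_r of the exponents belonging to the r-th cycle, in units of 1/k. *)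
Definition step r : nat := (k %/ len r)%N.

Lemma nuX_Rank n s (t : 'I_(len s)) :
  (nu X ^+ n)%g (tagnat.Rank s t) = tagnat.Rank s (iter n (@ordS _) t).
Proof.
elim: n => [|n IH]; first by rewrite expg0 perm1.
by rewrite expgSr permM IH nu_cycles.
Qed.

Lemma iter_ordS l n (t : 'I_l) : iter n (@ordS l) t = ((t + n) %% l)%N :> nat.
Proof.
elim: n => [|n IH] /=; first by rewrite addn0 modn_small.
by rewrite IH -addn1 modnDml addn1 addnS.
Qed.

Lemma Rank_inj s : injective (@tagnat.Rank _ (len (l := X)) s).
Proof.
by move=> t t' /(can_inj tagnat.rankK)/eqP; rewrite eq_Tagged => /eqP.
Qed.

Lemma nuX_first n r s : ((nu X ^+ n)%g (first s) == first r) =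
  (r == s) && (len s %| n)%N.
Proof.
rewrite nuX_Rank; apply/eqP/andP => [E|[/eqP-> sn]].
  have rs : r = s by have := congr1 tagnat.sig1 E; rewrite !tagnat.Rank1K.
  rewrite rs; split=> //; rewrite rs in E.
  by have := congr1 val (Rank_inj E); rewrite /= iter_ordS add0n => /eqP.
by congr tagnat.Rank; apply/val_inj; rewrite /= iter_ordS add0n; apply/eqP.
Qed.

Lemma len_ordnu s : (len s %| ordnu X)%N.
Proof.
have : (nu X ^+ ordnu X)%g (first s) == first s by rewrite expg_order perm1.
by rewrite nuX_first => /andP[].
Qed.

Lemma len_kk s : (len s %| k)%N.
Proof. exact/dvdn_mull/len_ordnu. Qed.

Lemma step_len s : (step s * len s = k)%N.
Proof. by rewrite divnK ?len_kk. Qed.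

Lemma step_gt0 s : (0 < step s)%N.
Proof. by have := kk_gt0 X; rewrite -(step_len s) muln_gt0 => /andP[]. Qed.

Lemma toh_alpha i : toh (alpha i) = delta_mx 0 i.
Proof. by apply/rowP => j; rewrite !mxE; case: (_ && _). Qed.

Lemma toh_nup n a : toh (nup n a) = nup n (toh a).
Proof. by apply/rowP => j; rewrite !mxE. Qed.

Lemma nup_alpha n i : nup n (alpha i) = alpha ((nu X ^+ n)%g i).
Proof.
apply/rowP => j; rewrite !mxE /= -[in RHS](permKV (nu X ^+ n)%g j).
by rewrite (inj_eq perm_inj).
Qed.

Lemma latN_nup a : latN eta (nup 1 a - a).
Proof.
move=> h h0; have {}h0 : nup 1 h = h by rewrite h0 expr0z scale1r.
rewrite tohD tohN (linB _ _ (hform_linearl h)) toh_nup.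
by rewrite -{1}h0 hform_nup subrr.
Qed.

Lemma alpha_first i : exists n, i = (nu X ^+ n)%g (first (tagnat.sig1 i)).
Proof.
exists (tagnat.sig2 i); rewrite nuX_Rank -[i in LHS]tagnat.sig2K;
  congr tagnat.Rank.
by apply/val_inj; rewrite /= iter_ordS add0n modn_small.
Qed.

Lemma latN_alpha i : latN eta (alpha i - alpha (first (tagnat.sig1 i))).
Proof.
have [n iE] := alpha_first i; rewrite {1}iE; elim: n {iE} => [|n IH].
  by rewrite expg0 perm1 subrr; exact: latN0.
rewrite -[n.+1]/(1 + n)%N -nup_alpha -nupD nup_alpha.
rewrite -(subrKA (alpha ((nu X ^+ n)%g (first (tagnat.sig1 i))))).
by apply: latND IH; exact: latN_nup.
Qed.

Lemma charge_alpha r i : charge r (alpha i) = (r == tagnat.sig1 i)%:R.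
Proof.
rewrite -(tagnat.sig2K i) tagnat.Rank1K /charge.
have [->|rs] := eqVneq r (tagnat.sig1 i).
  rewrite (bigD1 (tagnat.sig2 i)) //= big1 ?addr0 => [|t ti].
    by rewrite mxE !eqxx.
  by rewrite mxE (inj_eq (@Rank_inj _)) (negbTE ti).
apply: big1 => t _; rewrite mxE /=; case: eqP => // /(congr1 tagnat.sig1).
by rewrite !tagnat.Rank1K => /eqP; rewrite (negbTE rs).
Qed.

Lemma chargeB r a b : charge r (a - b) = charge r a - charge r b.
Proof.
rewrite chargeD; congr (_ + _); rewrite /charge -sumrN.
by apply: eq_bigr => t _; rewrite mxE.
Qed.

Lemma charge_nup r a : charge r (nup 1 a) = charge r a.
Proof.
rewrite /charge (reindex_inj (@ordS_inj _)) /=; apply: eq_bigr => t _.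
by rewrite mxE expg1 -nu_cycles permK.
Qed.

Hypothesis NM : forall a, latN eta a -> latM a.

(** An element of N has the form b - nu b, and the sum along a cycle is nu-invariant. *)
Lemma charge_latN r a : latN eta a -> charge r a = 0.
Proof. by move=> /NM[b ->]; rewrite chargeB charge_nup subrr. Qed.

(** If the integer determinant were zero, there would be a nonzero integral kernel vector, against
    positivity; a nonzero integer stays nonzero in C. *)
Lemma gram_unit : map_mx intr (gram X) \in @unitmx C (rk X).
Proof.
rewrite unitmxE unitfE det_map_mx intr_eq0; apply/det0P => -[v v0 vG].
by have := gram_pos v0; rewrite vG mul0mx mxE ltxx.
Qed.

Lemma hform_lambda j (h : hh) : hform (lambda C j) h = h 0 j.
Proof. by rewrite /hform -row_mul mulVmx ?gram_unit // -row_mul mul1mx !mxE.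
  Qed.

Lemma eta_pow_eq1 (n l : nat) : (l %| k)%N -> (eta ^+ (n * l) == 1) =
  ((k %/ l) %| n)%N.
Proof.
move=> lk; rewrite -(prim_order_dvd eta_prim) -{1}(divnK lk) dvdn_pmul2r //.
by apply: dvdn_gt0 lk; exact: kk_gt0.
Qed.

(** Since nu^(l_s) fixes alpha^(s), a nonzero projection to h_(z) forces eta^(z l_s) = 1. *)
Lemma proj_alpha0 (z : int) s : ~~ (step s %| `|z|)%N ->
  proj eta z (toh (alpha (first s))) = 0.
Proof.
move=> sz; set p := proj _ _ _.
have : p = eta ^ (z * (len s)%:Z) *: p.
  have E : nup (len s) (alpha (first s)) = alpha (first s).
    by rewrite nup_alpha; congr alpha; apply/eqP; rewrite nuX_first eqxx dvdnn.
  have projX n (h : hh) : proj eta z (nup n h) =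
    eta ^ (z * n%:Z) *: proj eta z h.
    elim: n => [|n IH]; first by rewrite nup0 mulr0 scale1r.
    rewrite -[n.+1]/(1 + n)%N -(nupD 1) proj_nup // IH scalerA.
    rewrite -expfzDr ?(eta_neq0 eta_prim) //; congr (eta ^ _ *: _);
      rewrite PoszD; ring.
  by rewrite -projX -toh_nup E.
move/eqP; rewrite -[X in X == _]scale1r -subr_eq0 -scalerBl scaler_eq0 subr_eq0.
case/orP => [/eqP e1|/eqP//]; case/negP: sz.
rewrite -eta_pow_eq1 ?len_kk //.
case: z {p} e1 => z e1; rewrite ?NegzE /= in e1 *.
  by apply/eqP; rewrite e1.
rewrite mulNr -invr_expz in e1; apply/eqP.
by apply: invr_inj; rewrite invr1 e1.
Qed.

Lemma hform_lambda_alpha (n : nat) r s :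
  hform (lambda C (first r)) (proj eta (- n%:Z) (toh (alpha (first s)))) =
  if (r == s) && (step s %| n)%N then (len s)%:R^-1 else 0.
Proof.
have [sn|sn] := boolP (step s %| n)%N; last first.
  by rewrite proj_alpha0 ?abszN // (lin0 (hform_linear _)) andbF.
rewrite andbT hform_lambda /proj mxE summxE.
(* Only the t divisible by l_s bring alpha^(s) back to itself, and for them eta^(n t) = 1. There are
   k / l_s of them, which gives 1 / l_s after division by k. *)
have entry (t : 'I_k) :
  (eta ^ (- (- n%:Z * t%:Z)) *: (nup t (toh (alpha (first s))) : hh)) 0
  (first r)
   = ((r == s) * (len s %| t))%N%:R.
  rewrite mxE -toh_nup nup_alpha toh_alpha mxE eqxx /= eq_sym nuX_first.
  rewrite -mulnb; case: (boolP (len s %| t)%N) => [/dvdnP[q ->]|_];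
    last by rewrite muln0 mulr0.
  rewrite mulNr opprK -PoszM mulnA mulnAC -exprnP exprM.
  have -> : eta ^+ (n * len s) = 1 by apply/eqP; rewrite eta_pow_eq1 ?len_kk.
  by rewrite expr1n mul1r.
rewrite (eq_bigr _ (fun t _ => entry t)) -natr_sum -big_distrr /=.
rewrite sum_dvdn ?kk_gt0 ?len_kk //.
case: (r == s); last by rewrite mul0n mulr0.
rewrite mul1n -/(step s) -[in X in X^-1 * _](step_len s) natrM invfM mulrAC
  mulVf ?mul1r //.
by rewrite pnatr_eq0 -lt0n step_gt0.
Qed.

End Orbits.

Lemma sum_linear_exp (C : fieldType) (V : lmodType C) (F : nat -> V) p
  (d : bool) l :
  \sum_(y < p.+1) ((y%:Z == 0)%:R - (d && (y%:Z == l%:Z))%:R) *: F y =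
  F 0 - (if d && (l <= p)%N then F l else 0).
Proof.
under eq_bigr do rewrite scalerBl.
rewrite sumrB; congr (_ - _).
  by rewrite big_ord_recl /= scale1r big1 ?addr0 // => y _; rewrite scale0r.
case: d => /=; last by rewrite big1 // => y _; rewrite scale0r.
case: leqP => lp.
  rewrite (bigD1 (Ordinal (lp : (l < p.+1)%N))) //= eqxx scale1r big1
    ?addr0 // => y.
  by rewrite -val_eqE eqz_nat /= => /negbTE->; rewrite scale0r.
by rewrite big1 // => y _; rewrite eqz_nat ltn_eqF ?scale0r // (leq_trans _ lp).
Qed.

(** * The operators E^+ and E^- on S[nu] *)

Section VertexModes.
Variables (C : numFieldType) (X : lattice_data) (eta : C).
Local Notation hh := (hh C X).
Local Notation k := (kk X).
Local Notation toh := (@toh C X).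
Local Notation S_mode := (@S_mode C X eta).

Definition pos_mode (h : hh) (n : nat) (v : Snu X eta) : Snu X eta :=
  - (n%:R / k%:R)^-1 *: S_mode n%:Z h v.

Definition neg_mode (h : hh) (n : nat) (v : Snu X eta) : Snu X eta :=
  - (- (n%:R / k%:R))^-1 *: S_mode (- n%:Z) h v.

Lemma pos_mode_linear h n : linear (pos_mode h n).
Proof.
move=> a x y; rewrite /pos_mode (linP a x y (S_mode_linear n h)).
by rewrite scalerDr !scalerA [a * _]mulrC.
Qed.

Lemma neg_mode_linear h n : linear (neg_mode h n).
Proof.
move=> a x y; rewrite /neg_mode (linP a x y (S_mode_linear (- n%:Z) h)).
by rewrite scalerDr !scalerA [a * _]mulrC.
Qed.

Lemma pos_mode0 h v : pos_mode h 0 v = 0.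
Proof. by rewrite /pos_mode mul0r invr0 oppr0 scale0r. Qed.

Lemma neg_mode0 h v : neg_mode h 0 v = 0.
Proof. by rewrite /neg_mode mul0r oppr0 invr0 oppr0 scale0r. Qed.

Lemma bracket_same (m n : int) (g h : hh) :
  (0 <= m) && (0 <= n) || (m <= 0) && (n <= 0) ->
  bracket eta m n g h = 0.
Proof.
move=> mn; rewrite /bracket; case: eqP => // mn0; have -> : m = 0 by lia.
by rewrite mul0r mulr0.
Qed.

Lemma pos_modeC g h m n v : pos_mode g m (pos_mode h n v) =
  pos_mode h n (pos_mode g m v).
Proof.
rewrite /pos_mode (linZ _ _ (S_mode_linear m%:Z g))
  (linZ _ _ (S_mode_linear n%:Z h)).
rewrite (S_mode_bracket m n g h v) (bracket_same (m := m) (n := n));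
  last by lia.
by rewrite scale0r addr0 !scalerA [X in X *: _]mulrC.
Qed.

Lemma neg_modeC g h m n v : neg_mode g m (neg_mode h n v) =
  neg_mode h n (neg_mode g m v).
Proof.
rewrite /neg_mode (linZ _ _ (S_mode_linear (- m%:Z) g))
  (linZ _ _ (S_mode_linear (- n%:Z) h)).
rewrite (S_mode_bracket (- m%:Z) (- n%:Z) g h v) bracket_same; last by lia.
by rewrite scale0r addr0 !scalerA [X in X *: _]mulrC.
Qed.

Hypothesis eta_prim : (kk X).-primitive_root eta.

Lemma scale_commutator (V : lmodType C) (a b c : C) (x y v : V) :
  x = y + b *: v -> a *: (c *: x) = c *: (a *: y) + (a * c * b) *: v.
Proof. by move=> ->; rewrite !scalerDr !scalerA [c * a]mulrC. Qed.

(* The commutator of the [n]-th terms in the exponents of [E^+ (- g, x)] and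
   [E^- (- h, y)]. *)
Definition mode_bracket (g h : hh) (n : nat) : C :=
  - (n%:R / k%:R)^-1 * hform g (proj eta (- n%:Z) h).

Lemma pos_neg_mode g h m n v : pos_mode g m (neg_mode h n v) =
  neg_mode h n (pos_mode g m v) + (if m == n then mode_bracket g h n else 0) *:
    v.
Proof.
rewrite /pos_mode /neg_mode (linZ _ _ (S_mode_linear m%:Z g)).
rewrite (linZ _ _ (S_mode_linear (- n%:Z) h)).
rewrite (scale_commutator _ _ (S_mode_bracket m (- n%:Z) g h v)).
congr (_ + _ *: _).
rewrite /bracket subr_eq0 eqz_nat; case: eqP => [->|_]; last by rewrite mulr0.
rewrite hform_projN // /mode_bracket; have [->|n0] := posnP n.
  by rewrite !mul0r !invr0 !oppr0 !mul0r.
have nR : n%:R != 0 :> C by rewrite pnatr_eq0 -lt0n.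
have kR := kk_neq0 C X; rewrite -pmulrn; field.
by rewrite kR nR.
Qed.

Lemma mode_bracket0 g h : mode_bracket g h 0 = 0.
Proof. by rewrite /mode_bracket mul0r invr0 oppr0 mul0r. Qed.

Notation Ep h := (expz (pos_mode h)).
Notation Em h := (expz (neg_mode h)).

Lemma Ep_linear h z : linear (Ep h z).
Proof. exact/expz_linear/pos_mode_linear. Qed.

Lemma Em_linear h z : linear (Em h z).
Proof. exact/expz_linear/neg_mode_linear. Qed.

Lemma Ep_Em g h (p : nat) (z : int) v : Ep g z (Em h p v) =
  \sum_(r < p.+1) scalar_exp (mode_bracket g h) r%:Z *:
     Em h (p%:Z - r%:Z) (Ep g (z - r%:Z) v).
Proof.
apply: (exp_exp (pos_mode_linear g) (neg_mode_linear h) (pos_mode0 g)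
  (neg_mode0 h)
  (pos_modeC g g) (neg_modeC h h) (pos_neg_mode g h) (mode_bracket0 g h)).
- exact: scalar_exp_neg.
- by rewrite scalar_exp0 // mode_bracket0.
- by move=> N y yN; exact: (scalar_exp_rec (mode_bracket0 g h)).
Qed.

Lemma Ep_lambda_Em r s (p : nat) (z : int) v :
  let a := toh (alpha (first s)) in let l := lambda C (first r) in
  Ep l z (Em a p v) = Em a p (Ep l z v) -
    (if r == s then Em a (p%:Z - (step s)%:Z) (Ep l (z - (step s)%:Z) v) else
      0).
Proof.
move=> a l.
pose e (y : int) : C := (y == 0)%:R - ((r == s) && (y == (step s)%:Z))%:R.
have e_neg (y : int) : y < 0 -> e y = 0.
  move=> y0; rewrite /e; have -> : (y == 0) = false by lia.
  by have -> : (y == (step s)%:Z) = false; [lia|rewrite andbF subrr].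
have e0 : e 0 = 1.
  by rewrite /e eqxx andbC; have := step_gt0 s; case: (step s) => // n _;
    rewrite subr0.
have e_rec N (y : int) : y < N%:Z -> y%:~R * e y =
    \sum_(n < N) n%:R * mode_bracket l a n * e (y - n%:Z).
  move=> yN; apply: (@linear_exp_rec _ (step s) (r == s)) => //.
    exact: step_gt0.
  (* The coefficient is - (k / n) / l_s = - step s / n, the n-th coefficient of the logarithm of 1 -
     t^(step s). *)
  move=> n n0; rewrite /mode_bracket hform_lambda_alpha //.
  case: ifP => _; last by rewrite !mulr0.
  have nR : n%:R != 0 :> C by rewrite pnatr_eq0 -lt0n.
  have lR : (len s)%:R != 0 :> C by rewrite pnatr_eq0 -lt0n len_gt0.
  have sR : (step s)%:R != 0 :> C by rewrite pnatr_eq0 -lt0n step_gt0.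
  by rewrite -(step_len s) natrM; field; rewrite nR lR sR.
have H := exp_exp (pos_mode_linear l) (neg_mode_linear a) (pos_mode0 l)
  (neg_mode0 a)
  (pos_modeC l l) (neg_modeC a a) (pos_neg_mode l a) (mode_bracket0 l a) e_neg
    e0 e_rec p z v.
apply: (etrans H).
rewrite (sum_linear_exp (fun y => Em a (p%:Z - y%:Z) (Ep l (z - y%:Z) v)) p
  (r == s) (step s)).
rewrite !subr0; congr (_ - _); case: (r == s) => /=; last by [].
(* For p below the step the shifted term is missing from the sum, and it is 0 because of its
   negative index. *)
by case: leqP => // ps; rewrite expz_neg //; lia.
Qed.

End VertexModes.

(** * Monomials in creation operators *)

Section Words.
Variable I : eqType.
Implicit Types (i j : I) (L : seq (I * nat)).

Definition nletters i L : nat := count (fun x : I * nat => x.1 == i) L.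

Definition dec i (x : I * nat) := if x.1 == i then (x.1, x.2.-1) else x.
Definition inc i (x : I * nat) := if x.1 == i then (x.1, x.2.+1) else x.

Lemma dec1 i x : (dec i x).1 = x.1. Proof. by rewrite /dec; case: ifP. Qed.
Lemma inc1 i x : (inc i x).1 = x.1. Proof. by rewrite /inc; case: ifP. Qed.

Lemma nletters_dec i j L : nletters j (map (dec i) L) = nletters j L.
Proof. by rewrite /nletters count_map; apply: eq_count => x /=;
  rewrite dec1. Qed.

Lemma incK i L : map (dec i) (map (inc i) L) = L.
Proof.
rewrite -map_comp -[RHS]map_id; apply: eq_map => -[j p] /=.
by rewrite /dec inc1 /inc /=; case: eqP => //= ->.
Qed.

Lemma decK i L : (i, 0) \notin L -> map (inc i) (map (dec i) L) = L.
Proof.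
move=> iL; rewrite -map_comp -[RHS]map_id; apply/eq_in_map => -[j p] jL /=.
rewrite /inc dec1 /dec /=; case: eqP => //= ji.
by case: p jL => // jL; rewrite -ji jL in iL.
Qed.

Lemma notin_inc i L : (i, 0) \notin map (inc i) L.
Proof.
apply/mapP => -[[j p] _]; rewrite /inc /=; case: eqP => [//|ji] [ij _].
by rewrite ij in ji.
Qed.

Lemma nletters_rem i j p L : (i, p) \in L ->
  nletters j L = ((i == j) + nletters j (rem (i, p) L))%N.
Proof. by move=> iL; rewrite /nletters (seq.permP (perm_to_rem iL)). Qed.

Lemma nletters_size0 L : (forall i, nletters i L = 0) -> L = [::].
Proof. by case: L => // -[i p] L /(_ i); rewrite /nletters /= eqxx. Qed.

Definition degree L : nat := \sum_(x <- L) x.2.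

Lemma degree_dec i L : (i, 0) \notin L ->
  (degree (map (dec i) L) + nletters i L = degree L)%N.
Proof.
rewrite /degree /nletters; elim: L => [|[j p] L IH]; first by rewrite !big_nil.
rewrite inE negb_or xpair_eqE eq_sym => /andP[jp iL].
rewrite /= !big_cons -(IH iL) /dec /=.
case: (j == i) jp => /=; last by rewrite add0n addnA.
by case: p => //= p _; lia.
Qed.

Lemma degree_rem i p L : (i, p) \in L ->
  (degree L = p + degree (rem (i, p) L))%N.
Proof. by move=> iL; rewrite /degree (perm_big _ (perm_to_rem iL)) big_cons.
  Qed.

End Words.

Section Monomials.
Variables (C : fieldType) (V : lmodType C) (I : eqType) (st : I -> nat).
Variables (vac : V) (em low : I -> int -> V -> V).
Hypothesis st_gt0 : forall i, (0 < st i)%N.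
Hypothesis vac_neq0 : vac != 0.
Hypothesis em_linear : forall i z, linear (em i z).
Hypothesis em0 : forall i v, em i 0 v = v.
Hypothesis em_neg : forall i z v, z < 0 -> em i z v = 0.
Hypothesis em_dvd : forall i p v, ~~ (st i %| p)%N -> em i p%:Z v = 0.
Hypothesis emC : forall i j y z v, em i y (em j z v) = em j z (em i y v).
Hypothesis low_linear : forall i z, linear (low i z).
Hypothesis low_vac : forall i z, low i z vac = if z == 0 then vac else 0.
Hypothesis low_em : forall i j (p : nat) z v, low i z (em j p%:Z v) =
  em j p%:Z (low i z v) -
  (if i == j then em j (p%:Z - (st j)%:Z) (low i (z - (st j)%:Z) v) else 0).
Implicit Types (i j : I) (L : seq (I * nat)).

Definition mono L : V :=
  foldr (fun x : I * nat => em x.1 (x.2 * st x.1)%N%:Z) vac L.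

Lemma mono_rem x L : x \in L -> mono L = mono (x :: rem x L).
Proof.
elim: L => //= y L IH; rewrite inE [y == x]eq_sym; have [->//|xy] := eqVneq x y.
by move=> /= /IH ->; rewrite /= emC.
Qed.

Lemma mono_perm L L' : perm_eq L L' -> mono L = mono L'.
Proof.
elim: L L' => [|x L IH] L' LL'.
  by move: LL'; rewrite perm_sym => /perm_nilP ->.
have xL' : x \in L' by rewrite -(perm_mem LL') mem_head.
rewrite (mono_rem xL') /= (IH (rem x L')) //.
by rewrite -(perm_cons x) (perm_trans LL') // perm_to_rem.
Qed.

(** Each letter of type i absorbs at most one shift by [st i], other letters and the vacuum none. *)
Lemma low_mono_gt i L (z : int) : (nletters i L * st i)%N%:Z < z ->
  low i z (mono L) = 0.
Proof.
elim: L z => [|[j p] L IH] z /=.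
  by rewrite /nletters mul0n low_vac => z0; rewrite gt_eqF.
rewrite /nletters /= -/(nletters i L) mulnDl PoszD => zw.
rewrite low_em; have [ij|ij] := eqVneq i j; last first.
  rewrite subr0 IH ?(lin0 (em_linear _ _)) //.
  by move: zw; rewrite eq_sym (negbTE ij) mul0n add0r.
move: zw; rewrite -ij eqxx mul1n => zw.
have zw' : (nletters i L * st i)%N%:Z < z - (st i)%:Z by rewrite ltrBrDl.
have {}zw : (nletters i L * st i)%N%:Z < z.
  by apply: lt_trans zw' _; rewrite gtrBl ltz_nat.
by rewrite (IH _ zw) (IH _ zw') !(lin0 (em_linear _ _)) subr0.
Qed.

(** At this extreme index every letter of type i has to absorb its shift. Each one contributes a
    factor -1, and a letter [(i, 0)] would be pushed to a negative index. *)
Lemma low_mono i L : low i (nletters i L * st i)%N%:Z (mono L) =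
  if (i, 0) \in L then 0 else (-1) ^+ nletters i L *: mono (map (dec i) L).
Proof.
elim: L => [|[j p] L IH] /=; first by rewrite /nletters low_vac eqxx scale1r.
rewrite /nletters /= -/(nletters i L) low_em inE xpair_eqE.
have [ij|ij] := eqVneq i j; last first.
  have ji : (j == i) = false by rewrite eq_sym (negbTE ij).
  rewrite add0n subr0 IH /= /dec /= ji.
  by case: ifP => _; rewrite ?(lin0 (em_linear _ _)) //
    (linZ _ _ (em_linear _ _)).
rewrite -ij /= /dec /= eqxx /= mulnDl mul1n.
(* If the first letter absorbs nothing, the index left for the other letters is too high. *)
rewrite low_mono_gt; last by rewrite ltz_nat -[X in (X < _)%N]add0n ltn_add2r.
rewrite (lin0 (em_linear _ _)) sub0r PoszD [_%:Z + _ - _]addrAC subrr add0r IH.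
case: p => [|p] /=.
  by rewrite em_neg ?oppr0 // mul0n sub0r oppr_lt0 ltz_nat.
have -> : (p.+1 * st i)%N%:Z - (st i)%:Z = (p * st i)%N%:Z.
  by rewrite mulSn PoszD addrAC subrr add0r.
rewrite exprS mulN1r scaleNr.
by case: ifP => _; rewrite ?(lin0 (em_linear _ _)) ?oppr0 //
  (linZ _ _ (em_linear _ _)).
Qed.

Lemma sum_scale_const (W : lmodType C) (T : eqType) (s : seq (C * T))
  (f : T -> W) y :
  (forall p, p \in s -> f p.2 = y) -> \sum_(p <- s) p.1 *: f p.2 =
    (\sum_(p <- s) p.1) *: y.
Proof.
by move=> fy; rewrite scaler_suml big_seq [RHS]big_seq;
  apply: eq_bigr => p /fy->.
Qed.

(* [low i (n i * st i)] kills the words with a letter [(i, 0)] and lowers the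
   other ones, so both parts of the relation reduce to words of smaller size or
   degree. Testing against all [f] invariant under permutation avoids choosing
   normal forms. *)
Lemma mono_inc_free n (s : seq (C * seq (I * nat))) :
  (forall p, p \in s -> forall i, nletters i p.2 = n i) ->
  \sum_(p <- s) p.1 *: mono p.2 = 0 ->
  forall (W : lmodType C) (f : seq (I * nat) -> W),
    (forall L L', perm_eq L L' -> f L = f L') -> \sum_(p <- s) p.1 *: f p.2 = 0.
Proof.
have [N] := ubnP (\max_(p <- s) (size p.2 + degree p.2)).
elim: N n s => // N IH n s; rewrite ltnS => /bigmax_leqP_seq sN sn s0 W f fP.
case: s => [|[c0 [|[i p0] L0]] s] in sN sn s0 *; first by rewrite big_nil.
  set t := _ :: _ in sN sn s0 *.
  (* An empty first word makes every [n i] zero, so all the words are empty. *)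
  have tnil p : p \in t -> p.2 = [::].
    by move=> pt; apply: nletters_size0 => i;
      rewrite (sn _ pt) -(sn _ (mem_head _ _)).
  rewrite (sum_scale_const (y := f [::])) => [|p /tnil->//].
  move: s0; rewrite (sum_scale_const (y := vac)) => [|p /tnil->//].
  by move/eqP; rewrite scaler_eq0 (negbTE vac_neq0) orbF => /eqP->;
    rewrite scale0r.
set t := _ :: _ in sN sn s0 *.
(* Here i is the type of the first letter of the first word; positivity of [n i] makes the degree
   drop strictly under lowering. *)
have ni0 : (0 < n i)%N by rewrite -(sn _ (mem_head _ _)) /nletters /= eqxx.
pose z (p : C * seq (I * nat)) := (i, 0) \in p.2.
pose t1 := [seq (p.1, map (dec i) p.2) | p <- t & ~~ z p].
have t1n p : p \in t1 -> forall j, nletters j p.2 = n j.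
  case/mapP => q; rewrite mem_filter => /andP[_ qt] -> j /=.
  by rewrite nletters_dec sn.
have t1N : (\max_(p <- t1) (size p.2 + degree p.2) < N)%N.
  apply: leq_ltn_trans (_ : N.-1 < N)%N; last first.
    have := sN _ (mem_head _ _) isT; rewrite /= addSn => h; rewrite prednK //.
    exact: leq_trans h.
  apply/bigmax_leqP_seq => q /mapP[p];
    rewrite mem_filter => /andP[zp pt] -> _ /=.
  have := sN _ pt isT; rewrite size_map -(degree_dec zp) (sn _ pt) addnA => h.
  rewrite -ltnS prednK; last by apply: leq_trans ni0 (leq_trans _ h);
    rewrite leq_addl.
  by apply: leq_trans h; rewrite -addn1 leq_add2l.
have t1_0 : \sum_(p <- t1) p.1 *: mono p.2 = 0.
  have lowt : \sum_(p <- t) p.1 *: low i (n i * st i)%N%:Z (mono p.2) = 0.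
    have := congr1 (low i (n i * st i)%N%:Z) s0.
    rewrite (lin0 (low_linear _ _)) (lin_sum _ _ _ (low_linear _ _)) => lows0.
    rewrite -[RHS]lows0; apply: eq_bigr => p _.
    by rewrite (linZ _ _ (low_linear _ _)).
  apply: (@scalerI _ _ ((-1) ^+ n i)); first by rewrite signr_eq0.
  rewrite scaler0 -[RHS]lowt big_map big_filter scaler_sumr.
  rewrite [RHS](bigID z) /= [X in _ = X + _]big1_seq ?add0r; last first.
    by move=> p /andP[zp pt]; rewrite -(sn _ pt) low_mono -/(z p) zp scaler0.
  rewrite big_seq_cond [RHS]big_seq_cond; apply: eq_bigr => p /andP[pt zp].
  by rewrite -(sn _ pt) low_mono -/(z p) (negbTE zp) !scalerA mulrC.
(* The induction hypothesis for the lowered words, composed with raising. It is used twice: for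
   [mono], to isolate the words with a letter [(i, 0)], and for f. *)
have noz (W' : lmodType C) (g : seq (I * nat) -> W') :
    (forall L L', perm_eq L L' -> g L = g L') ->
    \sum_(p <- t | ~~ z p) p.1 *: g p.2 = 0.
  move=> gP; have := IH _ _ t1N t1n t1_0 _ (fun L => g (map (inc i) L)).
  rewrite big_map big_filter big_seq_cond => H.
  rewrite big_seq_cond -[RHS]H; first by apply: eq_bigr => p /andP[_ zp] /=;
    rewrite decK.
  by move=> L L' LL'; apply/gP/perm_map.
(* A letter [(i, 0)] acts as the identity, so dropping it keeps the vector and shortens the word. *)
pose t2 := [seq (p.1, rem (i, 0) p.2) | p <- t & z p].
pose n2 j := (n j - (i == j))%N.
have t2n p : p \in t2 -> forall j, nletters j p.2 = n2 j.
  case/mapP => q; rewrite mem_filter => /andP[zq qt] -> j /=.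
  by rewrite /n2 -(sn _ qt) (nletters_rem j zq) addKn.
have t2N : (\max_(p <- t2) (size p.2 + degree p.2) < N)%N.
  apply: leq_ltn_trans (_ : N.-1 < N)%N; last first.
    have := sN _ (mem_head _ _) isT; rewrite /= addSn => h; rewrite prednK //.
    exact: leq_trans h.
  apply/bigmax_leqP_seq => q /mapP[p];
    rewrite mem_filter => /andP[zp pt] -> _ /=.
  have := sN _ pt isT; rewrite (degree_rem zp) add0n size_rem // => h.
  have p_gt0 : (0 < size p.2)%N by move: zp; rewrite /z; case: (p.2).
  have aux (a b c : nat) : (a + b <= c)%N -> (0 < a)%N ->
    (a.-1 + b <= c.-1)%N by lia.
  exact: aux h p_gt0.
have t2_0 : \sum_(p <- t2) p.1 *: mono p.2 = 0.
  have := s0; rewrite (bigID z) /= (noz _ _ mono_perm) addr0 big_map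
    big_filter => H.
  rewrite big_seq_cond -[RHS]H [RHS]big_seq_cond;
    apply: eq_bigr => p /andP[_ zp] /=.
  by rewrite (mono_rem zp) /= mul0n em0.
rewrite (bigID z) /= (noz _ _ fP) addr0.
have := IH _ _ t2N t2n t2_0 _ (fun L => f ((i, 0) :: L)).
rewrite big_map big_filter => H; rewrite big_seq_cond -[RHS]H.
  rewrite [RHS]big_seq_cond; apply: eq_bigr => p /andP[_ zp] /=.
  by rewrite (fP _ _ (perm_to_rem zp)).
by move=> L L' LL'; apply: fP; rewrite perm_cons.
Qed.

End Monomials.

Lemma nletters_size (I : eqType) (L L' : seq (I * nat)) :
  (forall i, nletters i L = nletters i L') -> size L = size L'.
Proof.
move=> LL'; rewrite -(size_map fst) -[RHS](size_map fst); apply: perm_size.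
by apply/allP => i _; rewrite /= !count_map; apply/eqP; exact: LL'.
Qed.

Lemma lspan_image (C : fieldType) (V : lmodType C) (T : Type) (F : T -> V) x :
  lspan (range F) x ->
  exists s : seq (C * T), x = \sum_(p <- s) p.1 *: F p.2.
Proof.
move: x; apply: lspan_ind => [|a _ y [t _ <-] [s ->]]; first by exists [::];
  rewrite big_nil.
by exists ((a, t) :: s); rewrite big_cons.
Qed.

(** * Degrees and letter counts under E^+ and E^- *)

Section Homogeneous.
Variables (C : fieldType) (V : lmodType C) (I : eqType) (st : I -> nat).
Variables (vac : V) (em : I -> int -> V -> V).
Hypothesis em_linear : forall i z, linear (em i z).
Hypothesis em_neg : forall i z v, z < 0 -> em i z v = 0.
Hypothesis em_dvd : forall i p v, ~~ (st i %| p)%N -> em i p%:Z v = 0.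
Implicit Types (i j : I) (L : seq (I * nat)).
Local Notation mono := (mono st vac em).

Definition wdegree L : nat := \sum_(x <- L) x.2 * st x.1.

(** The degree is an integer, so that an annihilation index can be subtracted without a side
    condition; a negative degree forces the vector 0. *)
Definition homog (n : I -> nat) (d : int) : set V :=
  lspan [set v | exists L,
    [/\ forall i, nletters i L = n i, (wdegree L)%:Z = d & v = mono L]].

Lemma homog_neg n d v : d < 0 -> homog n d v -> v = 0.
Proof.
move=> d0; move: v; apply: lspan_ind => // a x y [L [_ Ld _]] _.
by move: d0; rewrite -Ld.
Qed.

Lemma homog_em n d j z v : homog n d v ->
  homog (fun i => (j == i) + n i)%N (d + z) (em j z v).
Proof.
move: v; apply: lspan_lin => // _ [L [Ln Ld ->]].
have em0 : em j z (mono L) = 0 ->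
  homog (fun i => (j == i) + n i)%N (d + z) (em j z (mono L)).
  by move=> ->; exact: lspan0.
case: z em0 => [p|p] em0; last by apply: em0; rewrite em_neg.
have [/dvdnP[q pq]|sp] := boolP (st j %| p)%N; last by apply/em0/em_dvd.
apply: lspan_ge; exists ((j, q) :: L); split=> [i||] /=.
- by rewrite /nletters /= -Ln.
- by rewrite /wdegree big_cons /= -pq addnC PoszD -Ld.
- by rewrite -pq.
Qed.

Lemma homog_ext n n' d d' v : n =1 n' -> d = d' -> homog n d v -> homog n' d' v.
Proof. by move=> /funext -> ->. Qed.

Variables (ep : int -> V -> V) (e : I -> int -> C).
Hypothesis ep_vac : forall z, ep z vac = if z == 0 then vac else 0.
Hypothesis ep_em : forall j (p : nat) z v, ep z (em j p%:Z v) =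
  \sum_(r < p.+1) e j r%:Z *: em j (p%:Z - r%:Z) (ep (z - r%:Z) v).

(** In each term of [ep_em] the letter loses r while the annihilation index drops to z - r, so the
    total degree is always lowered by z. *)
Lemma homog_ep L z : homog (fun l => nletters l L) ((wdegree L)%:Z - z)
  (ep z (mono L)).
Proof.
elim: L z => [|[j p] L IH] z /=.
  rewrite ep_vac /wdegree big_nil; case: eqP => [->|_]; last exact: lspan0.
  by apply: lspan_ge; exists [::]; rewrite /wdegree big_nil.
rewrite ep_em; apply: lspan_sum => r _; apply: lspanZ.
have := homog_em j ((p * st j)%N%:Z - r%:Z) (IH (z - r%:Z)).
apply: homog_ext => [i|]; first by rewrite /nletters.
by rewrite /wdegree big_cons /= PoszD; ring.
Qed.

Lemma ep_mono_gt L z : (wdegree L)%:Z < z -> ep z (mono L) = 0.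
Proof. by move=> Lz; apply: homog_neg (homog_ep L z); rewrite subr_lt0. Qed.

End Homogeneous.

(** * The span of the monomials: generation by modes and exactness *)

Section Principal.
Variables (C : fieldType) (V U : lmodType C) (I : eqType) (st : I -> nat).
Variables (vac : V) (em : I -> int -> V -> V) (u : seq (I * nat) -> U).
Hypothesis em_linear : forall i z, linear (em i z).
Hypothesis em0 : forall i v, em i 0 v = v.
Hypothesis em_neg : forall i z v, z < 0 -> em i z v = 0.
Hypothesis em_dvd : forall i p v, ~~ (st i %| p)%N -> em i p%:Z v = 0.
Hypothesis emC : forall i j y z v, em i y (em j z v) = em j z (em i y v).
Hypothesis u_nletters : forall L L', (forall i, nletters i L = nletters i L') ->
  u L = u L'.
Implicit Types (i j : I) (L : seq (I * nat)).
Local Notation mono := (mono st vac em).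
Local Notation T := (tensor V U).

Definition monoT L : T := tens (mono L) (u L).
Definition principal : set T := lspan (range monoT).

Lemma nletters_perm L L' : perm_eq L L' -> forall i, nletters i L =
  nletters i L'.
Proof. by move=> /seq.permP LL' i; exact: LL'. Qed.

Lemma monoT_perm L L' : perm_eq L L' -> monoT L = monoT L'.
Proof.
by move=> LL'; rewrite /monoT (mono_perm st vac emC LL')
  (u_nletters (nletters_perm LL')).
Qed.

Lemma principal_homog n d v L : homog st vac em n d v ->
  (forall i, nletters i L = n i) ->
  principal (tens v (u L)).
Proof.
move=> vn Ln; move: v vn;
  apply: (lspan_lin (tens_linearl (u L))) => _ [L' [L'n _ ->]].
rewrite (u_nletters (L' := L')); last by move=> i; rewrite Ln L'n.
by apply: lspan_ge; exists L'.
Qed.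

Section Generation.
Variables (J : eqType) (Y : J -> int -> T -> T) (o : J -> I)
  (ep : J -> int -> V -> V).
Variable e : J -> I -> int -> C.
Hypothesis ep0 : forall (j : J) v, ep j 0 v = v.
Hypothesis ep_vac : forall (j : J) z, ep j z vac = if z == 0 then vac else 0.
Hypothesis ep_em : forall (l : J) j (p : nat) z v, ep l z (em j p%:Z v) =
  \sum_(r < p.+1) e l j r%:Z *: em j (p%:Z - r%:Z) (ep l (z - r%:Z) v).
Hypothesis Y_linear : forall (j : J) m a x y, principal x -> principal y ->
  Y j m (a *: x + y) = a *: Y j m x + Y j m y.
Hypothesis Y_mono : forall (j : J) m L, exists z (c : nat -> C),
  Y j m (monoT L) = \sum_(q < (wdegree st L).+1)
     c q *: tens (em (o j) (z + q%:Z) (ep j q%:Z (mono L))) (u ((o j, 0) :: L)).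
Hypothesis Y_surj : forall i L (p : nat), exists (j : J) m (c : nat -> C),
  [/\ c 0 != 0 & Y j m (monoT L) = \sum_(q < (wdegree st L).+1)
     c q *: tens (em i (p%:Z + q%:Z) (ep j q%:Z (mono L))) (u ((i, 0) :: L))].

Definition generated : set T :=
  lspan [set v | exists s : seq (J * int),
    v = foldr (fun p => Y p.1 p.2) (tens vac (u [::])) s].

Lemma homog_em_ep i (j : J) L p q :
  homog st vac em (fun l => nletters l ((i, 0) :: L))
  ((wdegree st L)%:Z - q + p) (em i p (ep j q (mono L))).
Proof.
have := homog_em em_linear em_neg em_dvd i p
  (homog_ep em_linear em_neg em_dvd (ep_vac j) (@ep_em j) L q).
exact: homog_ext.
Qed.

Lemma Y_principal (j : J) m x : principal x -> principal (Y j m x).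
Proof.
(* Membership of x is carried along because [Y j m] is linear only on [principal]. *)
move=> xA; suff : principal x /\ principal (Y j m x) by case.
move: x xA; apply: lspan_ind => [|a _ y [L _ <-] [yA YyA]].
  have A0 : principal 0 by exact: lspan0.
  split=> //; have := Y_linear j m (-1) A0 A0.
  by rewrite scaler0 addr0 scaleN1r addNr => ->.
have LA : principal (monoT L) by apply: lspan_ge; exists L.
split; first by apply: lspanD => //; exact: lspanZ.
rewrite Y_linear //; apply: lspanD => //; apply: lspanZ.
have [z [c ->]] := Y_mono j m L; apply: lspan_sum => q _; apply: lspanZ.
by apply: principal_homog (homog_em_ep _ _ _ _ _) _.
Qed.

Lemma generated_principal x : generated x -> principal x.
Proof.
apply: lspan_min => _ [s ->]; elim: s => [|p s IH] /=; last exact: Y_principal.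
by apply: lspan_ge; exists [::].
Qed.

Lemma Y_generated (j : J) m x : generated x -> generated (Y j m x).
Proof.
move=> xG; suff : generated x /\ generated (Y j m x) by case.
move: x xG; apply: lspan_ind => [|a _ y [s ->] [yG YyG]].
  have A0 : principal 0 by exact: lspan0.
  split; first exact: lspan0.
  have := Y_linear j m (-1) A0 A0; rewrite scaler0 addr0 scaleN1r addNr => ->.
  exact: lspan0.
set x := foldr _ _ _; have xG : generated x by apply: lspan_ge; exists s.
have YxG : generated (Y j m x) by apply: lspan_ge; exists ((j, m) :: s).
split; first by apply: lspanD => //; exact: lspanZ.
by rewrite Y_linear; [apply: lspanD => //;
  exact: lspanZ|exact: generated_principal..].
Qed.

(** Induction on the length of the word, then on the degree of its tail. The mode given by [Y_surj]
    has the wanted vector as its term q = 0, up to the factor [c 0]; the terms q > 0 have words of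
    the same length whose tails have degree smaller by q. *)
Lemma principal_generated x : principal x -> generated x.
Proof.
apply: lspan_min => _ [L _ <-].
have [n] := ubnP (size L); elim: n L => // n IH [|[i p] L] Ln.
  by apply: lspan_ge; exists [::].
have [b] := ubnP (wdegree st L); elim: b i p L Ln => // b IHb i p L Ln Lb.
have [j [m [c [c0 YE]]]] := Y_surj i L (p * st i)%N.
have : generated (Y j m (monoT L)) by apply/Y_generated/IH.
rewrite {}YE big_ord_recl /= addr0 ep0 => YG.
set y := \sum_(_ < _) _ in YG; have yG : generated y.
  apply: lspan_sum => q _; apply: lspanZ.
  have := homog_ep em_linear em_neg em_dvd (ep_vac j) (@ep_em j) L
    (bump 0 q)%:Z.
  move: (ep j _ _) => v vL.
  pose F v := tens (em i ((p * st i)%N%:Z + (bump 0 q)%:Z) v) (u ((i, 0) :: L))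
    : T.
  have FL : linear F by apply: lin_comp (tens_linearl _) (em_linear _ _).
  rewrite -/(F v); move: v vL; apply: (lspan_lin FL) => _ [L' [L'L L'd ->]].
  rewrite /F -PoszD; have [/dvdnP[p' ->]|sp] :=
    boolP (st i %| p * st i + bump 0 q)%N; last first.
    by rewrite em_dvd // (lin0 (tens_linearl _)); exact: lspan0.
  rewrite (u_nletters (L := (i, 0) :: L) (L' := (i, p') :: L')); last first.
    by move=> l; rewrite /nletters /=; congr addn; exact/esym/L'L.
  apply: IHb; first by rewrite /= (nletters_size L'L).
  by move: L'd Lb; rewrite /bump leq0n add1n; lia.
have cm : generated (c 0 *: monoT ((i, p) :: L)).
  rewrite /monoT /= -(u_nletters (L := (i, 0) :: L)) //.
  rewrite -[X in generated X](addrK y); apply: lspanD => //.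
  by rewrite -scaleN1r; apply: lspanZ.
by rewrite -[monoT _](scalerK c0); apply: lspanZ.
Qed.

Lemma generated_eq : generated = principal.
Proof.
by apply/seteqP; split=> x;
  [exact: generated_principal|exact: principal_generated].
Qed.

End Generation.

Section Exactness.
Variable low : I -> int -> V -> V.
Hypothesis st_gt0 : forall i, (0 < st i)%N.
Hypothesis vac_neq0 : vac != 0.
Hypothesis low_linear : forall i z, linear (low i z).
Hypothesis low_vac : forall i z, low i z vac = if z == 0 then vac else 0.
Hypothesis low_em : forall i j (p : nat) z v, low i z (em j p%:Z v) =
  em j p%:Z (low i z v) -
  (if i == j then em j (p%:Z - (st j)%:Z) (low i (z - (st j)%:Z) v) else 0).
Hypothesis u_coord : forall L, exists phi : U -> C^o,
  [/\ linear phi, phi (u L) = 1 &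
      forall L', (exists i, nletters i L' != nletters i L) -> phi (u L') = 0].

(** Contraction with the functional of [u_coord] keeps only the words with the letter counts of the
    first one; [mono_inc_free] applies to them, and the remaining sum is shorter. *)
Lemma monoT_free (s : seq (C * seq (I * nat))) :
  \sum_(p <- s) p.1 *: monoT p.2 = 0 ->
  forall (W : lmodType C) (f : seq (I * nat) -> W),
    (forall L L', perm_eq L L' -> f L = f L') -> \sum_(p <- s) p.1 *: f p.2 = 0.
Proof.
have [n] := ubnP (size s); elim: n s => // n IH [|p0 s] sn s0 W f fP.
  by rewrite big_nil.
have : p0 \in p0 :: s by rewrite mem_head.
move: (p0 :: s) sn s0 => {s} t sn s0 p0t.
pose z (p : C * seq (I * nat)) :=
  `[< forall i, nletters i p.2 = nletters i p0.2 >].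
pose t1 := filter z t.
have t1_free (W' : lmodType C) (g : seq (I * nat) -> W') :
    (forall L L', perm_eq L L' -> g L = g L') ->
      \sum_(p <- t | z p) p.1 *: g p.2 = 0.
  move=> gP; rewrite -big_filter.
  apply: (mono_inc_free st_gt0 vac_neq0 em_linear em0 em_neg emC low_linear
    low_vac
    low_em (n := fun l => nletters l p0.2) _ _ gP).
    by move=> p; rewrite mem_filter => /andP[/asboolP].
  have [phi [phiL phi1 phi0]] := u_coord p0.2.
  have cL := tensor_contract_linear (S := V) phiL.
  have := congr1 (@tensor_contract _ V _ phi) s0.
  rewrite (lin0 cL) (lin_sum _ _ _ cL) (bigID z) /= [X in _ + X]big1 ?addr0;
    last first.
    move=> p /asboolPn/existsNP[i ip].
    rewrite (linZ _ _ cL) tensor_contract_tens // phi0 ?scale0r ?scaler0 //.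
    by exists i; apply/eqP.
  rewrite big_filter => H; rewrite -[RHS]H; apply: eq_bigr => p /asboolP pw.
  by rewrite (linZ _ _ cL) tensor_contract_tens // (u_nletters pw) phi1 scale1r.
rewrite (bigID z) /= t1_free // add0r -big_filter; apply: IH => //.
  rewrite size_filter; move: sn; rewrite -(count_predC z t) ltnS.
  apply: leq_trans; rewrite -addn1 addnC leq_add2r -has_count.
  by apply/hasP; exists p0 => //; apply/asboolP.
rewrite big_filter; have := s0; rewrite (bigID z) /= t1_free ?add0r //.
exact: monoT_perm.
Qed.

Variables (i : I) (f D : T -> T).
Hypothesis f_linear : linear f.
Hypothesis f_inj : forall x, f x = 0 -> x = 0.
Hypothesis f_mono : forall L,
  exists2 c, c != 0 & f (monoT L) = c *: monoT ((i, 0) :: L).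
Hypothesis D_linear : forall a x y, principal x -> principal y ->
  D (a *: x + y) = a *: D x + D y.
Hypothesis D_mono : forall L,
  D (monoT L) = if (i, 0) \in L then 0 else monoT (map (dec i) L).

Lemma principal_mono L : principal (monoT L).
Proof. by apply: lspan_ge; exists L. Qed.

Lemma D_sum (s : seq (C * seq (I * nat))) :
  D (\sum_(p <- s) p.1 *: monoT p.2) = \sum_(p <- s) p.1 *: D (monoT p.2).
Proof.
elim: s => [|p s IH].
  have A0 : principal 0 by exact: lspan0.
  rewrite !big_nil; have := D_linear (-1) A0 A0.
  by rewrite scaler0 addr0 scaleN1r addNr.
rewrite !big_cons D_linear ?IH //; first exact: principal_mono.
by apply: lspan_sum => q _; apply/lspanZ/principal_mono.
Qed.

Lemma principal_exact : short_exact principal principal principal f D.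
Proof.
have fA x : principal x -> principal (f x).
  apply: (lspan_lin f_linear) => _ [L _ <-].
  by have [c _ ->] := f_mono L; apply/lspanZ/principal_mono.
have DA x : principal x -> principal (D x).
  case/lspan_image => s ->; rewrite D_sum; apply: lspan_sum => p _;
    apply: lspanZ.
  by rewrite D_mono; case: ifP => _; [exact: lspan0|exact: principal_mono].
split.
- by split=> // a x y _ _; exact: f_linear.
- by split.
- by move=> x _; exact: f_inj.
- apply/seteqP; split=> y /=.
    case=> x xA <-; split; first exact: fA.
    have [s ->] := lspan_image xA; rewrite (lin_sum _ _ _ f_linear).
    under eq_bigr do rewrite (linZ _ _ f_linear).
    (* The scalars are chosen for all L at once, so that the image is again a sum over scaled
       words. *)
    have [c cE] : exists c : seq (I * nat) -> C, forall L,
        f (monoT L) = c L *: monoT ((i, 0) :: L).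
      have H L : {c | f (monoT L) = c *: monoT ((i, 0) :: L)}.
        by apply: cid; have [c _ ->] := f_mono L; exists c.
      by exists (fun L => sval (H L)) => L; exact: svalP (H L).
    under eq_bigr do rewrite cE scalerA.
    have := D_sum [seq (p.1 * c p.2, (i, 0) :: p.2) | p <- s].
    rewrite !big_map /= => ->; apply: big1 => p _.
    by rewrite D_mono mem_head scaler0.
  case=> yA; have [s ->] := lspan_image yA; rewrite D_sum => Ds0.
  pose z (p : C * seq (I * nat)) := (i, 0) \in p.2.
  (* The hypothesis is a relation between the lowered words; by [monoT_free] it persists when these
     are raised again. *)
  have no0 : \sum_(p <- s | ~~ z p) p.1 *: monoT p.2 = 0.
    have := @monoT_free [seq (p.1, map (dec i) p.2) | p <- s & ~~ z p].
    rewrite big_map big_filter => /(_ _ T (fun L => monoT (map (inc i) L))).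
    rewrite big_map big_filter => H.
    rewrite -[RHS]H.
    + by apply: eq_bigr => p zp /=; rewrite decK.
    + rewrite -[RHS]Ds0 [RHS](bigID z) /= [X in _ = X + _]big1 ?add0r.
        by apply: eq_bigr => p zp; rewrite D_mono -/(z p) (negbTE zp).
      by move=> p zp; rewrite D_mono -/(z p) zp scaler0.
    + by move=> L L' LL'; apply/monoT_perm/perm_map.
  rewrite (bigID z) /= no0 addr0.
  have fpre L : (i, 0) \in L -> exists2 x, principal x & f x = monoT L.
    move=> iL; have [c c0 fE] := f_mono (rem (i, 0) L).
    exists (c^-1 *: monoT (rem (i, 0) L)); first exact/lspanZ/principal_mono.
    by rewrite (linZ _ _ f_linear) fE scalerK // -(monoT_perm (perm_to_rem iL)).
  elim/big_rec: _ => [|p y' zp [x xA <-]]; first by exists 0;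
    [exact: lspan0|exact: lin0].
  have [x' x'A <-] := fpre _ zp.
  by exists (p.1 *: x' + x);
    [apply: lspanD => //; exact: lspanZ|rewrite f_linear].
- apply/seteqP; split=> y /=; first by case=> x xA <-; exact: DA.
  case/lspan_image => s ->.
  exists (\sum_(p <- s) p.1 *: monoT (map (inc i) p.2)).
    by apply: lspan_sum => p _; apply/lspanZ/principal_mono.
  have := D_sum [seq (p.1, map (inc i) p.2) | p <- s];
    rewrite !big_map /= => ->.
  by apply: eq_bigr => p _; rewrite D_mono (negbTE (notin_inc i p.2)) incK.
Qed.

End Exactness.
End Principal.

(** * The twisted principal subspace *)

Lemma expz_comm (C : fieldType) (V : lmodType C) (c c' : nat -> V -> V) y z v :
  (forall n, linear (c n)) -> (forall n, linear (c' n)) ->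
  (forall m n w, c m (c' n w) = c' n (c m w)) ->
  expz c y (expz c' z v) = expz c' z (expz c y v).
Proof.
move=> cL c'L cc'; have ec n w : expz c y (c' n w) = c' n (expz c y w).
  by rewrite (expz_map y w (c'L n) (c' := c)).
apply: (@expz_map _ _ _ c' c' (expz c y) z v) => //.
case: (y) => q; first exact: exp_coef_linear.
by move=> a x x' /=; rewrite scaler0 addr0.
Qed.

(** A sum over an infinite set is 0 by convention unless its support is finite; the bound N
    guarantees finiteness. *)
Lemma fsbig_nat (V : zmodType) (F : nat -> V) N :
  (forall q, (N <= q)%N -> F q = 0) -> \sum_(q \in [set: nat]) F q =
    \sum_(q < N) F q.
Proof.
move=> F0; rewrite -(fsbig_widen `I_N [set: nat]) //;
  first by rewrite -fsbig_ord.
by move=> q [_ /= /negP]; rewrite -leqNgt => /F0.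
Qed.

Lemma fsbig_nat2 (V : zmodType) (F : nat * nat -> V) N :
  (forall p q, (N <= p)%N || (N <= q)%N -> F (p, q) = 0) ->
  \sum_(pq \in [set: nat * nat]) F pq =
    \sum_(q < N) \sum_(p < N) F (p : nat, q : nat).
Proof.
move=> F0; rewrite -(fsbig_widen (`I_N `*` `I_N) [set: nat * nat]) //;
  last first.
  move=> [p q] [_ /= pq]; apply: F0; apply/negPn/negP; rewrite negb_or -!ltnNge.
  by move=> /andP[pN qN]; apply: pq.
rewrite exchange_big /= (eq_fsbigr (fun pq => (fun p q => F (p, q)) pq.1 pq.2)).
  rewrite -(pair_fsbig _ (fun p q => F (p, q))) // -fsbig_ord.
  by apply: eq_bigr => p _; rewrite -fsbig_ord.
by move=> [].
Qed.

Lemma scale_linear (C : fieldType) (V : lmodType C) (c b : C) (x y z : V) :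
  z = b *: x + y -> c *: z = b *: (c *: x) + c *: y.
Proof. by move=> ->; rewrite scalerDr !scalerA [c * b]mulrC. Qed.

Lemma scalerA3 (C : fieldType) (V : lmodType C) (a b c : C) (v : V) :
  a *: (b *: (c *: v)) = (a * (c * b)) *: v.
Proof. by rewrite !scalerA [c * b]mulrC mulrA. Qed.

Section TwistedPrincipal.
Variables (C : numFieldType) (X : lattice_data) (eta : C) (tau : lhat X -> C).
Hypothesis eta_prim : (kk X).-primitive_root eta.
Hypothesis NM : forall a : lat X, latN eta a -> latM a.
Hypothesis tau_neq0 : forall x : lhat X, latN eta x.2 -> tau x != 0.
Hypothesis tauM : forall x y : lhat X, latN eta x.2 -> latN eta y.2 ->
  tau (lhatnu_mul x y) = tau x * tau y.
Local Notation k := (kk X).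
Local Notation I := 'I_(ncyc X).
Local Notation J := 'I_(rk X).
Local Notation S := (Snu X eta).
Local Notation U := (UT eta tau).
Local Notation U_gen := (pgen (U_rel eta tau)).
Local Notation toh := (@toh C X).
Local Notation word := (seq (I * nat)).

Definition vacS : S := pgen (S_rel eta) [::].
(* In units of 1/k: [em s (p * step s)] is the coefficient h_(s,p), and the
   coefficients of [em s] at indices not divisible by [step s] vanish. *)
Definition em (s : I) (z : int) : S -> S :=
  expz (neg_mode (toh (alpha (first s)))) z.
Definition low (s : I) (z : int) : S -> S :=
  expz (pos_mode (lambda C (first s))) z.
Definition ep (j : J) (z : int) : S -> S := expz (pos_mode (toh (alpha j))) z.
Definition wt (L : word) : lat X :=
  \sum_(s < ncyc X) alpha (first s) *+ nletters s L.
Definition uT (L : word) : U := U_gen (sec (wt L)).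

Lemma em_linear s z : linear (em s z).
Proof. exact: Em_linear. Qed.

Lemma em0 s v : em s 0 v = v.
Proof. exact: (expz0 (neg_mode_linear _) (neg_mode0 _)). Qed.

Lemma em_neg s z v : z < 0 -> em s z v = 0.
Proof. exact: expz_neg. Qed.

Lemma em_dvd s p v : ~~ (step s %| p)%N -> em s p%:Z v = 0.
Proof.
rewrite /em; apply: (expz_step (neg_mode_linear _) (neg_mode0 _)
  (neg_modeC _ _)) => n w sn.
rewrite /neg_mode S_mode_proj proj_alpha0 ?abszN //.
by rewrite (lin0 (S_mode_linear_arg _ _)) scaler0.
Qed.

Lemma emC s t y z v : em s y (em t z v) = em t z (em s y v).
Proof. exact: (expz_comm _ _ _ (neg_mode_linear _) (neg_mode_linear _)
  (neg_modeC _ _)). Qed.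

Lemma expz_pos_vac h z : expz (pos_mode h) z vacS = if z == 0 then vacS else 0.
Proof.
have pv n : pos_mode h n vacS = 0.
  by rewrite /pos_mode S_mode_vac ?scaler0.
apply/esym; apply: (@expz_uniq _ _ _ (pos_mode_linear h) (pos_mode0 h)
  (fun z => if z == 0 then vacS else 0)) => [y y0||q|q].
- by rewrite lt_eqF.
- by [].
- rewrite scaler0 big1 // => n _; case: ifP => _; first by rewrite pv scaler0.
  by rewrite (lin0 (pos_mode_linear _ _)) scaler0.
- exact: (expz_recS (pos_mode_linear h) (pos_mode0 h) (pos_modeC h h)).
Qed.

Lemma low_linear s z : linear (low s z).
Proof. exact: Ep_linear. Qed.

Lemma low_vac s z : low s z vacS = if z == 0 then vacS else 0.
Proof. exact: expz_pos_vac. Qed.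

Lemma ep_vac j z : ep j z vacS = if z == 0 then vacS else 0.
Proof. exact: expz_pos_vac. Qed.

Lemma low_em s t (p : nat) z v : low s z (em t p%:Z v) =
  em t p%:Z (low s z v) -
  (if s == t then em t (p%:Z - (step t)%:Z) (low s (z - (step t)%:Z) v) else 0).
Proof. exact: Ep_lambda_Em. Qed.

Definition ep_scalar (j : J) (s : I) : int -> C :=
  scalar_exp (mode_bracket eta (toh (alpha j)) (toh (alpha (first s)))).

Lemma ep_em j s (p : nat) z v : ep j z (em s p%:Z v) =
  \sum_(r < p.+1) ep_scalar j s r%:Z *: em s (p%:Z - r%:Z) (ep j (z - r%:Z) v).
Proof. exact: Ep_Em. Qed.

Lemma uT_nletters L L' : (forall i, nletters i L = nletters i L') -> uT L =
  uT L'.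
Proof. by move=> LL'; rewrite /uT /wt; under eq_bigr do rewrite LL'. Qed.

Lemma charge_wt r L : charge r (wt L) = (nletters r L)%:Z.
Proof.
have charge_lin a b n : charge r (alpha a *+ n + b) =
  (r == tagnat.sig1 a)%:R *+ n + charge r b.
  elim: n => [|n IH]; first by rewrite !mulr0n !add0r.
  by rewrite !mulrS -!addrA chargeD IH charge_alpha.
have c0 : charge r (0 : lat X) = 0.
  by rewrite /charge big1 // => j _; rewrite mxE.
have -> : charge r (wt L) = \sum_(s < ncyc X) (r == s)%:R *+ nletters s L.
  rewrite /wt; elim/big_rec2: _ => // s y1 y2 _ <-.
  by rewrite charge_lin tagnat.Rank1K.
rewrite (bigD1 r) //= eqxx big1 ?addr0 => [|s]; first by rewrite -natz.
by rewrite eq_sym => /negbTE->; rewrite mul0rn.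
Qed.

(** The charges vanish on N and recover the letter counts, so words with different counts lie in
    different cosets of N. *)
Lemma uT_coord L : exists phi : U -> C^o,
  [/\ linear phi, phi (uT L) = 1 &
      forall L', (exists i, nletters i L' != nletters i L) -> phi (uT L') = 0].
Proof.
exists (@U_coord _ _ eta tau (sec (wt L))); split.
- exact: U_coord_linear.
- exact: U_coord_id.
- move=> L' [i /eqP LL']; apply: U_coord_neq => //= /charge_latN N; apply: LL'.
  by have := N NM i; rewrite chargeB !charge_wt => /eqP;
    rewrite subr_eq0 eqz_nat => /eqP.
Qed.

Local Notation T := (tensor S U).
Local Notation mT := (monoT (@step X) vacS em uT).
Local Notation PT := (principal (@step X) vacS em uT).
Local Notation mS := (mono (@step X) vacS em).

Lemma id_linear (V : lmodType C) : linear (id : V -> V).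
Proof. by []. Qed.

Lemma lact_linear x : linear (lact eta tau x).
Proof. apply: tensor_map_linear; [exact: id_linear|exact: U_act_linear]. Qed.

Lemma lact_tens x s u : lact eta tau x (tens s u) = tens s (U_act x u).
Proof. apply: tensor_map_tens; [exact: id_linear|exact: U_act_linear]. Qed.

Lemma tensor_lin_eq (W : lmodType C) (f g : T -> W) : linear f -> linear g ->
  (forall s u, f (tens s u) = g (tens s u)) -> f =1 g.
Proof. by move=> fL gL fg; apply: presented_lin_eq => // -[s u]; exact: fg. Qed.

Lemma lactK x y : lact eta tau (lhatnu_inv x) (lact eta tau x y) = y.
Proof.
move: y; apply: tensor_lin_eq.
- exact: lin_comp (lact_linear _) (lact_linear _).
- exact: id_linear.
- move=> s u; rewrite !lact_tens; congr (tens s _); move: u;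
  apply: presented_lin_eq.
  + exact: lin_comp (U_act_linear _) (U_act_linear _).
  + exact: id_linear.
  + by move=> z; rewrite !U_act_gen lhatnu_mulA lhatnu_mulVl lhatnu_1mul.
Qed.

Lemma lact_inj x y : lact eta tau x y = 0 -> y = 0.
Proof. by move=> xy; rewrite -(lactK x y) xy (lin0 (lact_linear _)). Qed.

Lemma wt_cons s p L : wt ((s, p) :: L) = alpha (first s) + wt L.
Proof.
rewrite /wt (eq_bigr (fun i =>
  alpha (first i) *+ (s == i) + alpha (first i) *+ nletters i L)).
  rewrite big_split /= (bigD1 s) //= eqxx mulr1n big1 ?addr0 // => i.
  by rewrite eq_sym => /negbTE->.
by move=> i _; rewrite -mulrnDr.
Qed.

Lemma U_act_uT (j : J) L : exists2 c, c != 0 &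
  U_act (sec (alpha j)) (uT L) = c *: uT ((tagnat.sig1 j, 0) :: L).
Proof.
rewrite /uT U_act_gen; apply: U_gen_coset => //=.
rewrite wt_cons opprD addrACA subrr addr0; exact: latN_alpha.
Qed.

Lemma lact_mono s L : exists2 c, c != 0 &
  lact eta tau (sec (alpha (first s))) (mT L) = c *: mT ((s, 0) :: L).
Proof.
have [c c0 cE] := U_act_uT (first s) L; exists c => //.
rewrite tagnat.Rank1K in cE; rewrite lact_tens cE (linZ _ _ (tens_linear _)).
have m0 : mS ((s, 0) :: L) = mS L by exact: em0.
by rewrite /monoT m0.
Qed.

Lemma hmode_linear n h : linear (hmode eta tau n h).
Proof. apply: tensor_map_linear; [exact: S_mode_linear|exact: id_linear]. Qed.

Lemma hmode_tens n h s u : hmode eta tau n h (tens s u) = tens (S_mode n h s) u.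
Proof. apply: tensor_map_tens; [exact: S_mode_linear|exact: id_linear]. Qed.

Lemma Eplus_linear h q : linear (Eplus (eta := eta) (tau := tau) h q).
Proof.
apply: exp_coef_linear => n a x y; rewrite (linP a x y (hmode_linear n h)).
by rewrite scalerDr !scalerA [a * _]mulrC.
Qed.

Lemma Eminus_linear h q : linear (Eminus (eta := eta) (tau := tau) h q).
Proof.
apply: exp_coef_linear => n a x y;
  rewrite (linP a x y (hmode_linear (- n%:Z) h)).
by rewrite scalerDr !scalerA [a * _]mulrC.
Qed.

Lemma Eplus_tens h (q : nat) s u :
  Eplus (eta := eta) (tau := tau) h q (tens s u) =
    tens (expz (pos_mode h) q s) u.
Proof.
apply/esym; apply: (exp_coef_map _ _ (tens_linearl u)) => n w.
by rewrite hmode_tens /pos_mode (linZ _ _ (tens_linearl u)).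
Qed.

Lemma Eminus_tens h (q : nat) s u :
  Eminus (eta := eta) (tau := tau) h q (tens s u) =
    tens (expz (neg_mode h) q s) u.
Proof.
apply/esym; apply: (exp_coef_map _ _ (tens_linearl u)) => n w.
by rewrite hmode_tens /neg_mode (linZ _ _ (tens_linearl u)).
Qed.

Lemma eigen0_proj h : eigen eta 0 (proj (X := X) eta 0 h).
Proof. exact: nup_proj. Qed.

Lemma xpow_linear h c : eigen eta 0 h -> linear (xpow eta tau h c).
Proof.
move=> h0; apply: tensor_map_linear; first exact: id_linear.
exact: U_xpow_linear.
Qed.

Lemma xpow_uT h c s L : eigen eta 0 h -> xpow eta tau h c (tens s (uT L)) =
  if hform h (toh (wt L)) == c then tens s (uT L) else 0.
Proof.
move=> h0; have uL : linear (@U_xpow C X eta tau h c) by exact: U_xpow_linear.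
rewrite /xpow (tensor_map_tens (@id_linear _) uL).
rewrite /uT U_xpow_gen //=; case: (_ == c) => //.
exact: (lin0 (tens_linear s)).
Qed.

Lemma sgn_linear s : linear (sgn eta tau s).
Proof.
apply: tensor_map_linear; first exact: id_linear.
by apply: U_sign_linear => a; exact: charge_latN.
Qed.

Lemma sgn_uT r s L : sgn eta tau r (tens s (uT L)) =
  (-1) ^+ nletters r L *: tens s (uT L).
Proof.
have sL : linear (@U_sign C X eta tau r).
  by apply: U_sign_linear => a; exact: charge_latN.
rewrite /sgn (tensor_map_tens (@id_linear _) sL).
rewrite /uT U_sign_gen; last by move=> a; exact: charge_latN.
by rewrite (linZ _ _ (tens_linear s)) /= charge_wt.
Qed.

Lemma hform_proj0 (g h : hh C X) : hform (proj eta 0 g) h =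
  hform g (proj eta 0 h).
Proof.
have E (g' h' : hh C X) : hform (proj eta 0 g') (proj eta 0 h') =
  hform g' (proj eta 0 h').
  by have := hform_projN eta_prim 0 g' h'; rewrite oppr0.
by rewrite hformC -E hformC E.
Qed.

Lemma toh_sum (F : I -> lat X) (n : I -> nat) :
  toh (\sum_(s < ncyc X) F s *+ n s) = \sum_(s < ncyc X) (n s)%:R *: toh (F s).
Proof.
apply/rowP => j; rewrite mxE !summxE rmorph_sum; apply: eq_bigr => s _ /=.
by rewrite !mxE mulmxnE rmorphMn /= mulr_natl.
Qed.

Lemma hform_lambda_wt r L :
  hform (proj eta 0 (lambda C (first r))) (toh (wt L)) =
    (nletters r L)%:R / (len r)%:R.
Proof.
have pL : linear (fun h : hh C X => hform (lambda C (first r)) (proj eta 0 h) :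
  C^o).
  exact: lin_comp (hform_linear _) (proj_linear eta 0).
rewrite hform_proj0 /wt toh_sum (lin_sum _ _ _ pL) (bigD1 r) //= big1 ?addr0 =>
  [|s sr].
  rewrite (linZ _ _ pL) -[X in proj eta X]oppr0 -[0 : int]/(0%N%:Z).
  by rewrite (hform_lambda_alpha eta_prim 0) eqxx dvdn0.
rewrite (linZ _ _ pL) -[X in proj eta X]oppr0 -[0 : int]/(0%N%:Z).
by rewrite (hform_lambda_alpha eta_prim 0) eq_sym (negbTE sr) scaler0.
Qed.

(** * The constant term of Delta^T on monomials *)

Section Shift.
Variable r : I.

Definition Delta_term (q : nat) (v : T) : T := let l := lambda C (first r) in
  sgn eta tau r (xpow eta tau (proj eta 0 l) (0 + q%:R / k%:R) (Eplus l q v)).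

Lemma Delta_term_linear q : linear (Delta_term q).
Proof.
apply: (lin_comp (sgn_linear r));
  apply: (lin_comp (xpow_linear _ (eigen0_proj _))).
exact: Eplus_linear.
Qed.

(** With n letters of type r, the power of x from lambda_(0) has exponent n / l_r, so only the index
    n * step r of E^+ reaches x^0. This is the extreme index of [low_mono], whose sign (-1)^n
    cancels against that of [sgn]. *)
Lemma Delta_term_mono (q : nat) L : Delta_term q (mT L) =
  if q == (nletters r L * step r)%N then
    (if (r, 0) \in L then 0 else mT (map (dec r) L)) else 0.
Proof.
rewrite /Delta_term /monoT Eplus_tens xpow_uT; last exact: eigen0_proj.
have kR := kk_neq0 C X.
have sR : (step r)%:R != 0 :> C by rewrite pnatr_eq0 -lt0n step_gt0.
have lR : (len r)%:R != 0 :> C by rewrite pnatr_eq0 -lt0n len_gt0.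
have -> : (hform (proj eta 0 (lambda C (first r))) (toh (wt L)) == 0 + q%:R /
  k%:R)
    = (q == (nletters r L * step r)%N).
  rewrite hform_lambda_wt add0r -[q == _](eqr_nat C) natrM.
  rewrite -[RHS](inj_eq (mulIf (invr_neq0 kR))) eq_sym; congr (_ == _).
  by rewrite -(step_len r) natrM; field; rewrite sR lR.
case: eqP => [->|_]; last exact: (lin0 (sgn_linear r)).
rewrite sgn_uT -[expz _ _ _]/(low r (nletters r L * step r)%N%:Z (mS L)).
rewrite (low_mono (@step_gt0 X) em_linear em_neg low_vac low_em).
case: ((r, 0) \in L); first by rewrite (lin0 (tens_linearl _)) scaler0.
rewrite (linZ _ _ (tens_linearl _)) scalerA -exprMn mulrNN mulr1 expr1n scale1r.
by rewrite (uT_nletters (L := L) (L' := map (dec r) L)) // => i;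
  rewrite nletters_dec.
Qed.

Lemma Delta_c_sum N v : (forall q, (N <= q)%N -> Delta_term q v = 0) ->
  Delta_c eta tau r v = \sum_(q < N) Delta_term q v.
Proof. exact: (@fsbig_nat T (fun q => Delta_term q v)). Qed.

Lemma Delta_term_finite v : PT v -> exists N, forall q, (N <= q)%N ->
  Delta_term q v = 0.
Proof.
move: v; apply: lspan_ind => [|a _ y [L _ <-] [N NP]].
  by exists 0 => q _; exact: (lin0 (Delta_term_linear q)).
exists (maxn N (nletters r L * step r).+1) => q.
rewrite geq_max => /andP[Nq Lq];
  rewrite (linP a _ y (Delta_term_linear q)) NP //.
by rewrite Delta_term_mono gtn_eqF // scaler0 addr0.
Qed.

Lemma Delta_c_linear a x y : PT x -> PT y ->
  Delta_c eta tau r (a *: x + y) =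
    a *: Delta_c eta tau r x + Delta_c eta tau r y.
Proof.
move=> /Delta_term_finite[N Nx] /Delta_term_finite[M My].
rewrite !(@Delta_c_sum (maxn N M)); last 3 first.
- by move=> q; rewrite geq_max => /andP[_]; exact: My.
- by move=> q; rewrite geq_max => /andP[Nq _]; exact: Nx.
- move=> q; rewrite geq_max => /andP[Nq Mq].
  by rewrite (linP a x y (Delta_term_linear q)) Nx // My // scaler0 addr0.
rewrite scaler_sumr -big_split /=; apply: eq_bigr => q _.
exact: (linP a x y (Delta_term_linear q)).
Qed.

Lemma Delta_c_mono L : Delta_c eta tau r (mT L) =
  if (r, 0) \in L then 0 else mT (map (dec r) L).
Proof.
rewrite (@Delta_c_sum (nletters r L * step r).+1).
  rewrite big_ord_recr /= big1 ?add0r => [|q _].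
    by rewrite Delta_term_mono eqxx.
  by rewrite Delta_term_mono ltn_eqF.
by move=> q Lq; rewrite Delta_term_mono gtn_eqF.
Qed.

End Shift.

Lemma hform_toh (a b : lat X) : hform (toh a) (toh b) = (lform a b)%:~R.
Proof.
by rewrite /hform /lform /toh map_trmx -!map_mxM mxE.
Qed.

Lemma hform_proj0_toh (a b : lat X) :
  hform (proj eta 0 (toh a)) (toh b) =
    (\sum_(j < k) lform (nup j a) b)%:~R / k%:R.
Proof.
rewrite /proj (linZ _ _ (hform_linearl _)) (lin_sum _ _ _ (hform_linearl _)).
rewrite (eq_bigr (fun j : 'I_k => (lform (nup j a) b)%:~R : C^o)) => [|j _].
  by rewrite -(rmorph_sum intr) /GRing.scale /= mulrC.
by rewrite mul0r oppr0 expr0z scale1r -toh_nup hform_toh.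
Qed.

(** This is k <a_(0), a_(0)> / 2: as nu^(k/2) = 1, the sum over k terms is twice the sum over the
    first half. Hence all exponents of x can be compared as integers. *)
Definition half_norm (a : lat X) : int := \sum_(j < ordnu X) lform (nup j a) a.

Lemma sum_kk (F : nat -> int) : (forall j, F (ordnu X + j)%N = F j) ->
  \sum_(j < k) F j = 2 * \sum_(j < ordnu X) F j.
Proof.
move=> FP; rewrite /kk mul2n -addnn big_split_ord /= mulr2n mulrDl mul1r.
by congr (_ + _); apply: eq_bigr => j _; rewrite FP.
Qed.

Lemma hform_proj0_norm (a : lat X) :
  hform (proj eta 0 (toh a)) (proj eta 0 (toh a)) / 2 =
    (half_norm a)%:~R / k%:R.
Proof.
rewrite hform_proj0 (proj_id eta_prim) -hform_proj0 hform_proj0_toh.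
rewrite (@sum_kk (fun j => lform (nup j a) a)) => [|j].
  by rewrite intrM; field; rewrite (kk_neq0 C X).
by rewrite addnC -nupD nup_ordnu.
Qed.

(** No factor 1 - eta^(-j) with 0 < j < k/2 vanishes, eta being primitive of order k. *)
Lemma sigma_neq0 (a : lat X) : sigma eta a != 0.
Proof.
rewrite mulf_neq0 ?expfz_neq0 ?pnatr_eq0 //.
rewrite big_nat; apply: (big_ind (fun x => x != 0)) => [|x y|j /andP[j0 jk]].
- exact: oner_neq0.
- exact: mulf_neq0.
rewrite expfz_neq0 // subr_eq0 eq_sym -invr_expz -(inj_eq invr_inj) invrK invr1.
rewrite -exprnP -(prim_order_dvd eta_prim) gtnNdvd //.
by apply: leq_trans jk _; rewrite /kk mul2n doubleK -addnn leq_addr.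
Qed.

(** * The modes of the twisted vertex operators on monomials *)

Section Vertex.
Variable j : J.
Let a := alpha j.
Let a0 := proj eta 0 (toh a).

Definition vertex_term (m : int) (pq : nat * nat) (v : T) : T :=
  Eminus (toh a) pq.1 (Eplus (toh a) pq.2 (lact eta tau (sec a)
    (xpow eta tau a0 (- (m%:~R / k%:R) - (lform a a)%:~R / 2
       - (hform a0 a0 / 2 - (lform a a)%:~R / 2) - pq.1%:R / k%:R + pq.2%:R /
         k%:R) v))).

Definition vertex_scalar : C := k%:R ^ (- (lform a a %/ 2)%Z) * sigma eta a.

Lemma vertex_scalar_neq0 : vertex_scalar != 0.
Proof. by rewrite mulf_neq0 ?sigma_neq0 ?expfz_neq0 ?kk_neq0. Qed.

Lemma vertex_term_linear m pq : linear (vertex_term m pq).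
Proof.
apply: (lin_comp (Eminus_linear _ _)); apply: (lin_comp (Eplus_linear _ _)).
apply: (lin_comp (lact_linear _)); exact: (xpow_linear _ (eigen0_proj _)).
Qed.

Lemma emode_sum m N v :
  (forall p q, (N <= p)%N || (N <= q)%N -> vertex_term m (p, q) v = 0) ->
  emode eta tau a m v = vertex_scalar *: \sum_(q < N) \sum_(p < N) vertex_term m
    (p : nat, q : nat) v.
Proof.
move=> H; have := @fsbig_nat2 T (fun pq => vertex_term m pq v) N H.
by move=> <-.
Qed.

(* The index of the mode of E^- in the term of (e^a)_m with no annihilator. *)
Definition vertex_shift (m : int) (L : word) : int :=
  - m - half_norm a - \sum_(i < k) lform (nup i a) (wt L).

(** Comparison of the powers of x, in units of 1/k: the creation index p is forced by m, q and the
    weight of the word. *)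
Lemma vertex_term_mono m (p q : nat) L : vertex_term m (p, q) (mT L) =
  if p%:Z == vertex_shift m L + q%:Z then
    tens (expz (neg_mode (toh a)) p (ep j q (mS L))) (U_act (sec a) (uT L))
  else 0.
Proof.
rewrite /vertex_term /monoT xpow_uT; last exact: eigen0_proj.
have -> : (hform a0 (toh (wt L)) == - (m%:~R / k%:R) - (lform a a)%:~R / 2
       - (hform a0 a0 / 2 - (lform a a)%:~R / 2) - p%:R / k%:R + q%:R / k%:R)
    = (p%:Z == vertex_shift m L + q%:Z).
  rewrite /a0 hform_proj0_toh hform_proj0_norm.
  set B := \sum_(i < k) _; set A := half_norm a.
  have -> : - (m%:~R / k%:R) - (lform a a)%:~R / 2
       - (A%:~R / k%:R - (lform a a)%:~R / 2) - p%:R / k%:R + q%:R / k%:R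
     = (- m - A - p%:Z + q%:Z)%:~R / k%:R :> C.
    by rewrite !intrD !rmorphN /= -!pmulrn; ring.
  rewrite (inj_eq (mulIf (invr_neq0 (kk_neq0 C X)))) eqr_int /vertex_shift -/A
    -/B.
  by apply/eqP/eqP; lia.
case: (_ == _).
  by rewrite lact_tens Eplus_tens Eminus_tens.
by rewrite (lin0 (lact_linear _)) (lin0 (Eplus_linear _ _))
  (lin0 (Eminus_linear _ _)).
Qed.

Lemma ep_mS_gt (q : nat) L : (wdegree (@step X) L < q)%N -> ep j q (mS L) = 0.
Proof.
move=> Lq; apply: (ep_mono_gt em_linear em_neg em_dvd (ep_vac j) (@ep_em j)).
by rewrite ltz_nat.
Qed.

Lemma vertex_term_mono0 m (p q : nat) L : (wdegree (@step X) L < q)%N ->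
  vertex_term m (p, q) (mT L) = 0.
Proof.
move=> Lq; rewrite vertex_term_mono ep_mS_gt //; case: (_ == _) => //.
rewrite (lin0 (Em_linear _ _)); exact: (lin0 (tens_linearl _)).
Qed.

Lemma vertex_term_finite m v : PT v -> exists N, forall p q,
  (N <= p)%N || (N <= q)%N -> vertex_term m (p, q) v = 0.
Proof.
move: v; apply: lspan_ind => [|b _ y [L _ <-] [N NP]].
  by exists 0 => p q _; exact: (lin0 (vertex_term_linear m (p, q))).
exists (maxn N (`|vertex_shift m L| + (wdegree (@step X) L).+1)) => p q pq.
rewrite (linP b _ y (vertex_term_linear m (p, q))) NP; last first.
  by move: pq; clear; lia.
case: (ltnP (wdegree (@step X) L) q) => Lq.
  by rewrite vertex_term_mono0 // scaler0 addr0.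
rewrite vertex_term_mono ifF ?scaler0 ?addr0 //.
by apply/negbTE/eqP; move: pq Lq; clear; lia.
Qed.

Lemma emode_linear m b x y : PT x -> PT y ->
  emode eta tau a m (b *: x + y) =
    b *: emode eta tau a m x + emode eta tau a m y.
Proof.
move=> /(vertex_term_finite m)[N Nx] /(vertex_term_finite m)[M My].
have lx p q : (maxn N M <= p)%N || (maxn N M <= q)%N -> vertex_term m (p, q) x =
  0.
  by move=> pq; apply: Nx; move: pq; clear; lia.
have ly p q : (maxn N M <= p)%N || (maxn N M <= q)%N -> vertex_term m (p, q) y =
  0.
  by move=> pq; apply: My; move: pq; clear; lia.
rewrite (emode_sum lx) (emode_sum ly) (@emode_sum m (maxn N M)) => [|p q pq];
  last first.
  by rewrite (linP b x y (vertex_term_linear m (p, q))) lx // ly // scaler0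
    addr0.
apply: scale_linear.
rewrite scaler_sumr -big_split /=; apply: eq_bigr => q _.
rewrite scaler_sumr -big_split /=; apply: eq_bigr => p _.
exact: (linP b x y (vertex_term_linear m (p : nat, q : nat))).
Qed.

(** If alpha_j = nu^n alpha^(i), the component in h_(-p) is multiplied by eta^(-n p), so the two
    series E^- differ by the substitution of eta^(-n) y for y. *)
Lemma neg_mode_orbit : exists2 b, b != 0 & forall (z : int) (v : S),
  expz (neg_mode (toh a)) z v = b ^ z *: em (tagnat.sig1 j) z v.
Proof.
have [n jE] := alpha_first j; exists (eta ^ (- n%:Z)).
  by rewrite expfz_neq0 // (eta_neq0 eta_prim).
move=> z v; apply: (expz_scale (neg_mode_linear _) (neg_mode_linear _)
  (neg_mode0 _)
  (neg_modeC _ _) (neg_modeC _ _)).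
  by rewrite expfz_neq0 // (eta_neq0 eta_prim).
move=> p w; rewrite /neg_mode /a {1}jE -nup_alpha toh_nup
  (S_mode_nupX eta_prim).
rewrite !scalerA mulrC; congr (_ * _ *: _).
by rewrite exprnP exprz_exp; congr (eta ^ _); ring.
Qed.

(** For each annihilation index q at most one creation index contributes. If [vertex_shift m L + q]
    is negative there is none, in agreement with the value 0 of [em] at negative indices. *)
Lemma emode_mono m L : exists2 c : nat -> C, (forall q, c q != 0) &
  emode eta tau a m (mT L) = \sum_(q < (wdegree (@step X) L).+1)
    c q *: tens (em (tagnat.sig1 j) (vertex_shift m L + q%:Z)
      (ep j q%:Z (mS L)))
                (uT ((tagnat.sig1 j, 0) :: L)).
Proof.
have [b b0 bE] := neg_mode_orbit; have [c c0 cE] := U_act_uT j L.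
set z := vertex_shift m L; set w := wdegree (@step X) L.
exists (fun q => vertex_scalar * (c * b ^ (z + q%:Z))) => [q|].
  apply: mulf_neq0; first exact: vertex_scalar_neq0.
  by apply: mulf_neq0 => //; apply: expfz_neq0.
(* Contributing terms have q <= w and p = z + q, so both indices stay below N. *)
pose N := (`|z| + w.+1)%N.
rewrite (@emode_sum m N) => [|p q pq]; last first.
  case: (ltnP w q) => wq; first by rewrite vertex_term_mono0.
  rewrite vertex_term_mono ifF //; apply/negbTE/eqP.
  by move: pq wq; rewrite /N -/z; clear; lia.
pose F (q : nat) := b ^ (z + q%:Z) *: tens
  (em (tagnat.sig1 j) (z + q%:Z) (ep j q%:Z (mS L)))
  (c *: uT ((tagnat.sig1 j, 0) :: L)) : T.
have inner (q : 'I_N) : \sum_(p < N) vertex_term m (p : nat, q : nat) (mT L) =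
    if (q < w.+1)%N then F q else 0.
  case: ifPn => qw; last first.
    by apply: big1 => p _; rewrite vertex_term_mono0 // ltnNge.
  case zq : (z + q%:Z) => [p|p]; last first.
    rewrite /F zq em_neg // (lin0 (tens_linearl _)) scaler0.
    by apply: big1 => p' _; rewrite vertex_term_mono -/z zq.
  have pN : (p < N)%N by move: zq qw; rewrite /N; clear; lia.
  rewrite (bigD1 (Ordinal pN)) //= [X in _ + X]big1 => [|p' p'p]; last first.
    rewrite vertex_term_mono -/z zq ifF // eqz_nat; apply/negbTE.
    by apply: contra p'p => /eqP p'p; apply/eqP/val_inj.
  rewrite addr0 vertex_term_mono -/z zq eqxx /F zq cE bE.
  by rewrite (linZ _ _ (tens_linearl _)).
rewrite (eq_bigr _ (fun q _ => inner q)) -big_mkcond /=.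
rewrite -(big_ord_widen N F) ?leq_addl // scaler_sumr.
apply: eq_bigr => q _; rewrite /F (linZ _ _ (tens_linear _)).
exact: scalerA3.
Qed.

End Vertex.

Lemma emode_Y_mono (j : J) m L : exists z (c : nat -> C),
  emode eta tau (alpha j) m (mT L) = \sum_(q < (wdegree (@step X) L).+1)
    c q *: tens (em (tagnat.sig1 j) (z + q%:Z) (ep j q%:Z (mS L)))
                (uT ((tagnat.sig1 j, 0) :: L)).
Proof. by have [c _ cE] := emode_mono j m L;
  exists (vertex_shift j m L), c. Qed.

Lemma emode_Y_surj (i : I) L (p : nat) : exists (j : J) m (c : nat -> C),
  c 0 != 0 /\ emode eta tau (alpha j) m (mT L) =
    \sum_(q < (wdegree (@step X) L).+1)
    c q *: tens (em i (p%:Z + q%:Z) (ep j q%:Z (mS L))) (uT ((i, 0) :: L)).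
Proof.
(* The solution m of [vertex_shift (first i) m L = p]. *)
pose m := - p%:Z - half_norm (alpha (first i)) -
  \sum_(l < k) lform (nup l (alpha (first i))) (wt L).
have [c c0] := emode_mono (first i) m L; rewrite tagnat.Rank1K.
have -> : vertex_shift (first i) m L = p by rewrite /vertex_shift /m; ring.
by move=> cE; exists (first i), m, c.
Qed.

Lemma ep0 (j : J) v : ep j 0 v = v.
Proof. exact: (expz0 (pos_mode_linear _) (pos_mode0 _)). Qed.

Lemma WLT_principal : WLT eta tau = PT.
Proof.
have vacE : vac eta tau = tens vacS (uT [::]).
  rewrite /vac /uT (_ : wt [::] = 0) // /wt.
  by apply: big1 => s _; rewrite mulr0n.
rewrite -(@generated_eq _ _ _ _ _ _ _ _ em_linear em_neg em_dvd uT_nletters _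
  (fun j m => emode eta tau (alpha j) m) (fun j => tagnat.sig1 j) ep ep_scalar
  ep0 ep_vac ep_em emode_linear emode_Y_mono emode_Y_surj).
by rewrite /WLT /generated vacE.
Qed.

Lemma WLT_exact (r : I) : short_exact (WLT eta tau) (WLT eta tau) (WLT eta tau)
  (lact eta tau (sec (alpha (first r)))) (Delta_c eta tau r).
Proof.
rewrite WLT_principal; apply: (principal_exact em_linear em0 em_neg emC
  uT_nletters (@step_gt0 X) (S_vac_neq0 eta_prim) low_linear low_vac low_em
    uT_coord (i := r)).
- exact: lact_linear.
- by move=> x; exact: lact_inj.
- exact: lact_mono.
- exact: Delta_c_linear.
- exact: Delta_c_mono.
Qed.

End TwistedPrincipal.

Theorem theorem4p2 (R : realType) (X : lattice_data) (eta : R[i])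
    (eta_prim : (kk X).-primitive_root%R eta)
    (NM : forall a : lat X, latN eta a <-> latM a)
    (NR : forall a : lat X, latN eta a <-> latR eta a)
    (nuhat : lhat X -> lhat X) (nuhatP : is_nuhat nuhat)
    (tau : lhat X -> R[i]) (tauP : is_tau eta nuhat tau)
    (r : 'I_(ncyc X)) :
  short_exact (WLT eta tau) (WLT eta tau) (WLT eta tau)
    (lact eta tau (sec (alpha (first r)))) (Delta_c eta tau r).
Proof.
case: tauP => tau_neq0 tauM _ _.
exact: (@WLT_exact (R[i] : numFieldType) X eta tau eta_prim
  (fun a => proj1 (NM a)) tau_neq0 tauM r).
Qed.
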